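(* Let $G$ be a group, $X,Z$ compact Hausdorff spaces, $\psi: G \curvearrowright X$ and $\varphi: G \curvearrowright Z$ actions by homeomorphisms, $P\subseteq Z$ the set of bounded parabolic points of $\varphi$, and $\pi: X \rightarrow Z$ a continuous surjective $G$-equivariant map such that $\#\pi^{-1}(x) = 1$ for all $x \in Z\setminus P$. For $p \in P$ put $W_{p} = X \setminus \pi^{-1}(p)$ and let $\psi^1_p: Stab_{\varphi}p\curvearrowright W_p$ be the restriction of $\psi$. The following are equivalent: \begin{enumerate} \item The map $\pi$ is topologically quasiconvex and, for every $p \in P$, $X \in EPers(\psi_{p}^{1})$ (with respect to the decomposition $X=W_p\sqcup \pi^{-1}(p)$). \item There exist a parabolic blowup $Z\ltimes \mathcal{C}$ of $Z$, with projection map $\pi': Z\ltimes\mathcal{C}\to Z$, and a $G$-equivariant homeomorphism $T: X \to Z\ltimes \mathcal{C}$ such that $\pi'\circ T=\pi$. \end{enumerate}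
   Context: Groups are discrete. An action of a group $H$ on a locally compact Hausdorff space $V$ is properly discontinuous if for every compact $K\subseteq V$ the set $\{h\in H: hK\cap K\neq\emptyset\}$ is finite, and cocompact if $HK=V$ for some compact $K\subseteq V$. Given an action by homeomorphisms $\varphi:G\curvearrowright Z$, $p\in Z$ is bounded parabolic if $Stab_\varphi p$ acts properly discontinuously and cocompactly on $Z\setminus\{p\}$. Uniform structure: a compact Hausdorff space has a unique compatible uniform structure; for an entourage $u$, a subset $A$ is $u$-small if $A\times A\subseteq u$. A continuous surjection $f:X\to Y$ of compact Hausdorff spaces is topologically quasiconvex if for every entourage $u$ of $X$ only finitely many fibers $f^{-1}(y)$ are not $u$-small. Gluing notation: $V+_fC$ denotes a topological space with underlying set $V\sqcup C$ in which $V$ is open and $V$, $C$ carry their given topologies; $f$ records the topology via $f(A)=\overline{A}\cap C$ for $A$ closed in $V$, so that $B\subseteq V\sqcup C$ is closed iff $B\cap V$, $B\cap C$ are closed in $V$, $C$ and $f(B\cap V)\subseteq B$. Perspectivity: let $\alpha:H\curvearrowright V$ be a properly discontinuous cocompact action on a locally compact Hausdorff space. $EPers(\alpha)$ is the class of compact Hausdorff spaces $V+_fC$ ($C$ compact) with an action of $H$ by homeomorphisms extending $\alpha$ and preserving $C$, such that for every entourage $u$ and every compact $K\subseteq V$ the set $\{h\in H: hK \text{ is not } u\text{-small}\}$ is finite. $EPers(H)$ means $EPers(L)$ where $L$ is left multiplication of $H$ on itself. (In the claim, $Stab_\varphi p$ does act properly discontinuously and cocompactly on $W_p$.) Given $H+_\partial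 C\in EPers(H)$ and a properly discontinuous cocompact action $\alpha:H\curvearrowright V$ on a locally compact Hausdorff space $V$, with compact $K\subseteq V$ such that $HK=V$, let $V+_{\partial_\Pi}C$ be the gluing given by $\partial_\Pi(S)=\partial(\{h\in H: hK\cap S\neq\emptyset\})$ for $S$ closed in $V$; it is independent of $K$ and belongs to $EPers(\alpha)$. Parabolic blowup: let $P'\subseteq P$ be a set of representatives of the $G$-orbits in $P$, and for each $p\in P'$ let $Stab_\varphi p+_{\partial_p}C_p\in EPers(Stab_\varphi p)$ with action $L_p+\eta_p$ ($L_p$ left multiplication, $\eta_p$ the action on $C_p$); $\mathcal C=\{C_p\}_{p\in P'}$, $\eta=\{\eta_p\}_{p\in P'}$. For $p\in P'$ and $q$ in its orbit choose $h_{p,q}\in G$ with $\varphi(h_{p,q},p)=q$ and $h_{p,p}=1$; put $C_q=C_p$ and let $Stab_\varphi q+_{\partial_q}C_q$ have the topology making the map $x\mapsto h_{p,q}^{-1}xh_{p,q}$ on $Stab_\varphi q$ together with $\mathrm{id}$ on $C_q=C_p$ a homeomorphism onto $Stab_\varphi p+_{\partial_p}C_p$. Let $X_q=(Z\setminus\{q\})+_{(\partial_q)_\Pi}C_q$ and let $\pi_q:X_q\to Z$ be the identity on $Z\setminus\{q\}$ and send $C_q$ to $q$. Then $Z\ltimes\mathcal C$ is the inverse limit $\{(z,(x_q)_{q\in P}): \pi_q(x_q)=z\ \forall q\}\subseteq Z\times\prod_{q\in P} X_q$, with projection to $Z$ given by $(z,(x_q))\mapsto z$. The group $G$ acts on it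 by $\varphi\ltimes\eta$, induced by $\varphi$ and the homeomorphisms $\psi_q(g,\cdot):X_q\to X_{\varphi(g,q)}$ equal to $\varphi(g,\cdot)$ on $Z\setminus\{q\}$ and to $\eta_p(h_{p,\varphi(g,q)}^{-1}gh_{p,q},\cdot)$ on $C_q$. ''A parabolic blowup of $Z$'' means such a space with this action, for some choice of the family of $Stab_\varphi p+_{\partial_p}C_p$.
   Formalization: The case where Z is a single point and G is infinite is excluded: there the point is vacuously bounded parabolic, (1) always holds, and (2) can fail, e.g. for G the integers acting on the circle X by an irrational rotation. *)

(* Defs.v *)
From HB Require Import structures.
From mathcomp Require Import all_boot.
From mathcomp Require Import all_classical.
From mathcomp Require Import topology_structure uniform_structure compact.
From mathcomp Require Import product_topology subtype_topology discrete_topology.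
From mathcomp Require Import separation_axioms function_spaces.

Set Implicit Arguments.
Unset Strict Implicit.
Unset Printing Implicit Defensive.

Local Open Scope classical_set_scope.

Section Uniformities.
Local Open Scope relation_scope.

(* The axioms of [uniformType] for a family of entourages inducing the given
   topology of [X]. *)
Record compatible_uniformity (X : topologicalType)
    (ent : set_system (X * X)) : Prop := CompatibleUniformity {
  cu_filter : Filter ent;
  cu_diagonal : forall u, ent u -> diagonal `<=` u;
  cu_inv : forall u, ent u -> ent u^-1;
  cu_split : forall u, ent u -> exists2 v, ent v & v \; v `<=` u;
  cu_nbhs : forall x : X, nbhs x = nbhs_ ent x }.

End Uniformities.

(* Only meant for compact Hausdorff [X], where the compatible uniformity exists
   and is unique. *)
Definition is_entourage (X : topologicalType) (u : set (X * X)) : Prop :=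
  exists2 ent, compatible_uniformity ent & ent u.

Definition small (X : Type) (u : set (X * X)) (A : set X) : Prop :=
  A `*` A `<=` u.

Definition quasiconvex (X Y : topologicalType) (f : X -> Y) : Prop :=
  forall u, is_entourage u -> finite_set [set y | ~ small u (f @^-1` [set y])].

Definition open_embedding (V Y : topologicalType) (i : V -> Y) : Prop :=
  [/\ injective i, continuous i & forall A, open A -> open (i @` A)].

Definition homeomorphism (X Y : topologicalType) (f : X -> Y) : Prop :=
  continuous f /\
  exists g : Y -> X, [/\ continuous g, cancel f g & cancel g f].

(* Continuity of every [a g] suffices, its inverse being [a g^-1]. *)
Record is_haction (G : groupType) (T : topologicalType) (a : G -> T -> T) :
    Prop := IsHAction {
  haction1 : forall x, a 1%g x = x;
  hactionM : forall g h x, a (g * h)%g x = a g (a h x);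
  haction_continuous : forall g, continuous (a g) }.

Record haction (G : groupType) (T : topologicalType) := HAction {
  act :> G -> T -> T;
  hactionP : is_haction act }.

Definition properly_discontinuous (H : groupType) (V : topologicalType)
    (a : haction H V) : Prop :=
  forall K : set V, compact K ->
    finite_set [set h | (a h @` K) `&` K !=set0].

Definition translates_cover (H : groupType) (V : topologicalType)
    (a : haction H V) (K : set V) : Prop :=
  forall v, exists h, exists2 k, K k & a h k = v.

Definition cocompact (H : groupType) (V : topologicalType)
    (a : haction H V) : Prop :=
  exists2 K : set V, compact K & translates_cover a K.

Section LeftMultiplication.
Variable H : groupType.

Definition lmul_fun (h : H) (x : discrete_topology H) : discrete_topology H :=
  (h * (x : H))%g.

Lemma lmul_is_haction : is_haction lmul_fun.
Proof.
split=> [x|g h x|g x]; rewrite /lmul_fun ?mul1g ?mulgA //.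
by move=> A /nbhs_singleton Ax; rewrite nbhs_principalE; apply/principal_filterP.
Qed.

Definition lmul : haction H (discrete_topology H) := HAction lmul_is_haction.

End LeftMultiplication.

Section Stabilizer.
Variables (G : groupType) (Z : topologicalType) (phi : haction G Z).

Lemma hactK g : cancel (phi g) (phi g^-1%g).
Proof.
by move=> x; rewrite -(hactionM (hactionP phi)) mulVg (haction1 (hactionP phi)).
Qed.

Lemma hactVK g : cancel (phi g^-1%g) (phi g).
Proof.
by move=> x; rewrite -(hactionM (hactionP phi)) mulgV (haction1 (hactionP phi)).
Qed.

Definition stab (p : Z) : set G := [set g | phi g p = p].

Definition Stab (p : Z) : Type := {g : G | g \in stab p}.

HB.instance Definition _ p := SubChoice.copy (Stab p) {g : G | g \in stab p}.

Lemma stab_group_closed p : group_closed (fun g => g \in stab p).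
Proof.
split=> [|g h]; rewrite unfold_in !inE /stab /= ?(haction1 (hactionP phi)) //.
by move=> gp hp; rewrite (hactionM (hactionP phi)) -{1}hp hactK.
Qed.

HB.instance Definition _ p :=
  SubChoice_isSubGroup.Build G _ (Stab p) (stab_group_closed p).

Lemma stabP p (h : Stab p) : phi (val h) p = p.
Proof. exact: (set_mem (valP h)). Qed.

(* The action of [Stab p] on an invariant subset [A] of a second [G]-space;
   [A] carries the subspace topology of [set_type]. *)
Section Restriction.
Variables (X : topologicalType) (psi : haction G X) (p : Z) (A : set X).
Hypothesis stabA : forall (h : Stab p) x, A x -> A (psi (val h) x).

Definition restr_fun (h : Stab p) (x : A) : A :=
  exist _ (psi (val h) (val x)) (mem_set (stabA h (set_valP x))).

Lemma restr_is_haction : is_haction restr_fun.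
Proof.
have psiP := hactionP psi; split=> [x|g h x|g].
- by apply: val_inj; rewrite /= (haction1 psiP).
- by apply: val_inj; rewrite /= (hactionM psiP).
apply/continuousP => _ [B oB <-].
have oB' : open (psi (val g) @^-1` B).
  by move/continuousP: (@haction_continuous _ _ _ psiP (val g)); apply.
by exists (psi (val g) @^-1` B).
Qed.

Definition restr_act : haction (Stab p) A := HAction restr_is_haction.
End Restriction.

Lemma stab_punctured p (h : Stab p) z : [set~ p] z -> [set~ p] (phi (val h) z).
Proof.
by move=> zp /= e; apply: zp; apply: (can_inj (hactK (val h))); rewrite e stabP.
Qed.

Definition punctured_act p : haction (Stab p) [set~ p] :=
  restr_act (@stab_punctured p).

Definition bounded_parabolic : set Z :=
  [set p | properly_discontinuous (punctured_act p) /\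
           cocompact (punctured_act p)].

Definition orbit (p : Z) : set Z := [set q | exists g, phi g p = q].

Lemma conj_stab p q h (hpq : phi h p = q) (x : Stab q) :
  stab p (h^-1 * val x * h)%g.
Proof.
by rewrite /stab /= !(hactionM (hactionP phi)) hpq stabP -hpq hactK.
Qed.

Definition stab_conj p q h (hpq : phi h p = q) (x : Stab q) : Stab p :=
  exist _ (h^-1 * val x * h)%g (mem_set (conj_stab hpq x)).

End Stabilizer.

(* The operators [f] for which [glue f] below is a topology; the values of [f]
   on nonclosed sets are irrelevant. *)
Record gluing_map (V C : topologicalType) := GluingMap {
  gluing :> set V -> set C;
  gluing_closed : forall A, closed A -> closed (gluing A);
  gluing0 : gluing set0 = set0;
  gluingU : forall A B, closed A -> closed B ->
    gluing (A `|` B) = gluing A `|` gluing B }.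

Definition glue (V C : topologicalType) (f : gluing_map V C) : Type :=
  (V + C)%type.

Section Gluing.
Variables (V C : topologicalType) (f : gluing_map V C).

Definition glue_inl (v : V) : glue f := inl v.
Definition glue_inr (c : C) : glue f := inr c.

Definition glue_closed (B : set (glue f)) : Prop :=
  [/\ closed (glue_inl @^-1` B), closed (glue_inr @^-1` B)
    & f (glue_inl @^-1` B) `<=` glue_inr @^-1` B].

Definition glue_open (U : set (glue f)) : Prop := glue_closed (~` U).

Lemma gluingS A B : closed A -> closed B -> A `<=` B -> f A `<=` f B.
Proof. by move=> cA cB /setUidPr <-; rewrite gluingU //; exact: subsetUl. Qed.

Lemma glue_openT : glue_open setT.
Proof.
by rewrite /glue_open setCT; split; rewrite ?preimage_set0 ?gluing0;
  try exact: closed0.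
Qed.

Lemma glue_openI : setI_closed glue_open.
Proof.
move=> A B [A1 A2 A3] [B1 B2 B3]; rewrite /glue_open setCI; split.
- by rewrite preimage_setU; exact: closedU.
- by rewrite preimage_setU; exact: closedU.
- by rewrite !preimage_setU gluingU //; exact: setUSS.
Qed.

Lemma glue_open_bigcup (I : Type) (U : I -> set (glue f)) :
  (forall i, glue_open (U i)) -> glue_open (\bigcup_i U i).
Proof.
move=> oU; rewrite /glue_open setC_bigcup.
have c1 : closed (glue_inl @^-1` \bigcap_i ~` U i).
  by rewrite preimage_bigcap; apply: closed_bigI => i _; have [] := oU i.
split=> //.
  by rewrite preimage_bigcap; apply: closed_bigI => i _; have [] := oU i.
move=> c fc i _; have [ci _] := oU i; apply.
by apply: gluingS fc => // v; apply.
Qed.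

HB.instance Definition _ := Choice.copy (glue f) (V + C)%type.
HB.instance Definition _ := isOpenTopological.Build (glue f)
  glue_openT glue_openI glue_open_bigcup.

Lemma glue_closedP (B : set (glue f)) : closed B <-> glue_closed B.
Proof. by rewrite -openC -{2}[B]setCK. Qed.

(* The topology of [glue f] records [f] as the boundary operator. *)
Lemma glue_closure (A : set V) : closed A ->
  glue_inr @^-1` closure (glue_inl @` A) = f A.
Proof.
move=> cA; apply/seteqP; split=> c.
  have cl : closed (glue_inl @` A `|` glue_inr @` f A).
    have e1 : glue_inl @^-1` (glue_inl @` A `|` glue_inr @` f A) = A.
      by apply/seteqP; split=> v; [case=> [[w Aw [<-]]|[]] | left; exists v].
    have e2 : glue_inr @^-1` (glue_inl @` A `|` glue_inr @` f A) = f A.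
      by apply/seteqP; split=> v; [case=> [[]|[w Aw [<-]]] // | right; exists v].
    by apply/glue_closedP; split; rewrite ?e1 ?e2 //; exact: gluing_closed.
  rewrite /= closureE => /(_ _ (conj cl _))[]; first by left.
    by case.
  by case=> d fd [<-].
move=> fc; rewrite /= closureE => B [/glue_closedP[B1 B2 B3] AB].
by apply: B3; apply: gluingS fc => // v Av; apply: AB; exists v.
Qed.

Definition sum_act (H : groupType) (a : haction H V) (e : haction H C)
    (h : H) (y : glue f) : glue f :=
  match y with inl v => glue_inl (a h v) | inr c => glue_inr (e h c) end.

End Gluing.

(* [Y], with the action [w], is an element of EPers(a): [i] identifies [V] with
   an open subset of [Y], and [C] is the complement [~` range i] with the
   subspace topology. *)
Record EPers (H : groupType) (V Y : topologicalType) (a : haction H V)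
    (i : V -> Y) (w : H -> Y -> Y) : Prop := MkEPers {
  EPers_compact : compact [set: Y];
  EPers_hausdorff : hausdorff_space Y;
  EPers_embedding : open_embedding i;
  EPers_remainder : compact (~` range i);
  EPers_haction : is_haction w;
  EPers_extends : forall h v, w h (i v) = i (a h v);
  EPers_preserves : forall h y, (~` range i) y -> (~` range i) (w h y);
  EPers_perspective : forall (u : set (Y * Y)) (K : set V),
    is_entourage u -> compact K ->
    finite_set [set h | ~ small u (w h @` (i @` K))] }.

(* An element of EPers(H); the action is left multiplication on [H] and [pg_act]
   on the remainder. *)
Record pers_group (H : groupType) := PersGroup {
  pg_C : topologicalType;
  pg_bd : gluing_map (discrete_topology H) pg_C;
  pg_act : haction H pg_C;
  pg_EPers : EPers (lmul H) (@glue_inl _ _ pg_bd) (sum_act (lmul H) pg_act) }.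

Section Pi.
Variables (H : groupType) (V C : topologicalType) (a : haction H V).
Variables (K : set V) (bd : gluing_map (discrete_topology H) C).

Definition Pi_fun (S : set V) : set C :=
  bd [set h : discrete_topology H | (a h @` K) `&` S !=set0].

Lemma Pi_fun0 : Pi_fun set0 = set0.
Proof.
rewrite -(gluing0 bd) /Pi_fun; congr (gluing bd _).
by apply/seteqP; split=> h // [x []].
Qed.

Lemma Pi_funU A B : Pi_fun (A `|` B) = Pi_fun A `|` Pi_fun B.
Proof.
rewrite /Pi_fun -gluingU; try exact: discrete_closed.
congr (gluing bd _); apply/seteqP; split=> h.
  by move=> [x [Kx [Ax|Bx]]]; [left|right]; exists x.
by move=> [|] [x [Kx Ax]]; exists x; split=> //; [left|right].
Qed.

Definition Pi_gluing : gluing_map V C :=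
  @GluingMap V C Pi_fun
    (fun S _ => @gluing_closed _ _ bd _ (discrete_closed _))
    Pi_fun0 (fun A B _ _ => Pi_funU A B).
End Pi.

Section Transport.
Variables (H H' : groupType) (C : topologicalType) (c : H' -> H).
Variable bd : gluing_map (discrete_topology H) C.

Definition transport_fun (S : set (discrete_topology H')) : set C :=
  bd ((c : discrete_topology H' -> discrete_topology H) @` S).

Lemma transport_fun0 : transport_fun set0 = set0.
Proof. by rewrite /transport_fun image_set0 gluing0. Qed.

Lemma transport_funU A B :
  transport_fun (A `|` B) = transport_fun A `|` transport_fun B.
Proof.
by rewrite /transport_fun image_setU gluingU //; exact: discrete_closed.
Qed.

Definition transport_gluing : gluing_map (discrete_topology H') C :=
  @GluingMap _ C transport_fun
    (fun S _ => @gluing_closed _ _ bd _ (discrete_closed _))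
    transport_fun0 (fun A B _ _ => transport_funU A B).

Definition transport_map (y : glue transport_gluing) : glue bd :=
  match y with inl x => inl (c x) | inr z => inr z end.

Lemma transport_homeomorphism : bijective c -> homeomorphism transport_map.
Proof.
move=> [d cd dc].
pose inv (y : glue bd) : glue transport_gluing :=
  match y with inl x => inl (d x) | inr z => inr z end.
split; last first.
  exists inv; split=> [|[x|z]|[x|z]] //=; rewrite ?cd ?dc //.
  apply/continuous_closedP => B /glue_closedP[_ B2 B3]; apply/glue_closedP.
  split=> //; first exact: discrete_closed.
  apply: (subset_trans _ B3); apply: (@gluingS _ _ bd); try exact: discrete_closed.
  by move=> x Bx; exists (d x) => //; rewrite dc.
apply/continuous_closedP => B /glue_closedP[_ B2 B3]; apply/glue_closedP.
split=> //; first exact: discrete_closed.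
apply: (subset_trans _ B3); apply: (@gluingS _ _ bd); try exact: discrete_closed.
by move=> _ [x Bx <-].
Qed.

End Transport.

(* The choices made before the family of perspective compactifications: a set of
   orbit representatives, elements [transl p q] carrying [p] to [q], and compact
   sets [core q] whose translates by the stabilizer of [q] cover the complement
   of [q]. *)
Record blowup_frame (G : groupType) (Z : topologicalType)
    (phi : haction G Z) := BlowupFrame {
  reps : set Z;
  repsP : reps `<=` bounded_parabolic phi;
  reps_exists : forall q, bounded_parabolic phi q ->
    exists2 p, reps p & orbit phi p q;
  reps_unique : forall p p', reps p -> reps p' -> orbit phi p p' -> p = p';
  transl : Z -> Z -> G;
  translP : forall p q, reps p -> orbit phi p q -> phi (transl p q) p = q;
  transl1 : forall p, reps p -> transl p p = 1%g;
  core : forall q : Z, set [set~ q];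
  core_compact : forall q, bounded_parabolic phi q -> compact (@core q);
  core_cover : forall q, bounded_parabolic phi q ->
    translates_cover (punctured_act phi q) (@core q) }.

Arguments core {G Z phi} F q : rename.

Lemma blowup_frame_exists (G : groupType) (Z : topologicalType)
  (phi : haction G Z) : inhabited (blowup_frame phi).
Proof.
have phiP := hactionP phi.
pose P := bounded_parabolic phi.
pose E (z : Z) : set Z := [set y | P y /\ orbit phi z y].
pose rep z := xget z (E z).
have orbM a b c : orbit phi a b -> orbit phi b c -> orbit phi a c.
  by move=> [g ga] [h hb]; exists (h * g)%g; rewrite (hactionM phiP) ga.
have orbV a b : orbit phi a b -> orbit phi b a.
  by move=> [g <-]; exists g^-1%g; rewrite hactK.
have orb1 a : orbit phi a a by exists 1%g; rewrite (haction1 phiP).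
have repP q : P q -> E q (rep q) by move=> Pq; apply: (xgetPex q); exists q.
have repE p q : P p -> P q -> orbit phi p q -> rep p = rep q.
  move=> Pp Pq pq; have EE : E p = E q.
    apply/seteqP; split=> y [Py py]; split=> //.
      exact: orbM (orbV _ _ pq) py.
    exact: orbM pq py.
  rewrite /rep EE.
  rewrite /xget; case: pselect => // -[]; exists q.
  by apply/asboolP; split=> //; exact: orb1.
have [t tP] : exists t : Z -> Z -> G, forall p q,
    (orbit phi p q -> phi (t p q) p = q) /\ (p = q -> t p q = 1%g).
  have H (pq : Z * Z) : exists g, (orbit phi pq.1 pq.2 -> phi g pq.1 = pq.2) /\
      (pq.1 = pq.2 -> g = 1%g).
    case: (pselect (pq.1 = pq.2)) => [->|ne].
      by exists 1%g; split=> // _; rewrite (haction1 phiP).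
    case: (pselect (orbit phi pq.1 pq.2)) => [[g e]|no].
      by exists g; split=> // /ne.
    by exists 1%g; split=> // /no.
  have [t tP] := choice H.
  by exists (fun p q => t (p, q)) => p q; exact: (tP (p, q)).
pose good q : set (set [set~ q]) :=
  [set K | compact K /\ translates_cover (punctured_act phi q) K].
have KP q : P q -> good q (xget set0 (good q)).
  by move=> [_ [K cK KK]]; apply: (xgetPex set0); exists K.
constructor; apply: (@BlowupFrame _ _ phi [set p | P p /\ rep p = p] _ _ _ t _ _
  (fun q => xget set0 (good q))).
- by move=> p [].
- move=> q Pq; have [Pr qr] := repP q Pq; exists (rep q); last exact: orbV.
  by split=> //; apply/esym/repE.
- by move=> p p' [Pp rp] [Pp' rp'] /(repE _ _ Pp Pp'); rewrite rp rp'.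
- by move=> p q _; exact: (tP p q).1.
- by move=> p _; exact: (tP p p).2.
- by move=> q /KP[].
- by move=> q /KP[].
Qed.

Section Blowup.
Variables (G : groupType) (Z : topologicalType) (phi : haction G Z).
Variables (F : blowup_frame phi) (D : forall p : reps F, pers_group (Stab phi (val p))).

Section Fiber.
Variable p : reps F.

Lemma transl_eq (q : orbit phi (val p)) : phi (transl F (val p) (val q)) (val p) = val q.
Proof. exact: translP (set_valP p) (set_valP q). Qed.

Definition bd_at (q : orbit phi (val p)) :
    gluing_map (discrete_topology (Stab phi (val q))) (pg_C (D p)) :=
  transport_gluing (stab_conj (transl_eq q)) (pg_bd (D p)).

Definition blowup_at (q : orbit phi (val p)) : topologicalType :=
  glue (Pi_gluing (punctured_act phi (val q)) (core F (val q)) (bd_at q)).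

Definition blowup_at_proj (q : orbit phi (val p)) (x : blowup_at q) : Z :=
  match x with inl z => val z | inr _ => val q end.

Lemma punctured_move (q q' : Z) g (gq : phi g q = q') (z : [set~ q]) :
  [set~ q'] (phi g (val z)).
Proof. by rewrite -gq /= => /(can_inj (hactK phi g)) zq; exact: (set_valP z zq). Qed.

Lemma transl_stab (q q' : orbit phi (val p)) g : phi g (val q) = val q' ->
  stab phi (val p) ((transl F (val p) (val q'))^-1 * g * transl F (val p) (val q))%g.
Proof.
move=> gq; rewrite /stab /= !(hactionM (hactionP phi)) transl_eq gq.
by rewrite -[X in phi _ X](transl_eq q') hactK.
Qed.

(* Keeping [q'] and the proof that it is [phi g q] as arguments avoids casts
   between the spaces [blowup_at q]. *)
Definition blowup_at_act (q q' : orbit phi (val p)) g (gq : phi g (val q) = val q')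
    (x : blowup_at q) : blowup_at q' :=
  match x with
  | inl z => inl (exist _ (phi g (val z)) (mem_set (@punctured_move _ _ _ gq z)))
  | inr c => inr (pg_act (D p)
      (exist _ ((transl F (val p) (val q'))^-1 * g * transl F (val p) (val q))%g
        (mem_set (transl_stab gq))) c)
  end.

Lemma orbit_move (q : orbit phi (val p)) g : orbit phi (val p) (phi g (val q)).
Proof.
have [h hq] := set_valP q; exists (g * h)%g.
by rewrite (hactionM (hactionP phi)) hq.
Qed.

Definition move_pt g (q : orbit phi (val p)) : orbit phi (val p) :=
  exist _ (phi g (val q)) (mem_set (orbit_move q g)).

End Fiber.

(* The points [q] of [bounded_parabolic phi], each paired with the unique [p] in
   [reps F] whose orbit contains it. *)
Definition blowup_index : Type := {p : reps F & orbit phi (val p)}.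

Definition blowup_factor (j : blowup_index) : topologicalType :=
  blowup_at (projT2 j).

Definition blowup_set : set (Z * prod_topology blowup_factor) :=
  [set w | forall j, blowup_at_proj (w.2 j) = w.1].

Definition blowup : topologicalType := set_type blowup_set.

Definition blowup_proj (w : blowup) : Z := (val w).1.

Definition blowup_act_fun (g : G) (w : Z * prod_topology blowup_factor) :
    Z * prod_topology blowup_factor :=
  (phi g w.1,
   fun j => let: existT p q := j return blowup_factor j in
     blowup_at_act (hactVK phi g (val q) : phi g (val (move_pt g^-1%g q)) = val q)
       (w.2 (existT _ p (move_pt g^-1%g q)))).

Lemma blowup_act_subproof g (w : blowup) : blowup_set (blowup_act_fun g (val w)).
Proof.
move=> [p q] /=; have := set_valP w (existT _ p (move_pt g^-1%g q)).
case: ((val w).2 _) => [z|c] /= <- //=.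
by rewrite hactVK.
Qed.

Definition blowup_act (g : G) (w : blowup) : blowup :=
  exist _ (blowup_act_fun g (val w)) (mem_set (blowup_act_subproof g w)).

End Blowup.

Section Complements.
Variables (G : groupType) (X Z : topologicalType).
Variables (psi : haction G X) (phi : haction G Z) (pi : X -> Z).
Hypothesis pi_equivariant : forall g x, pi (psi g x) = phi g (pi x).

Definition fiber_compl (p : Z) : set X := ~` (pi @^-1` [set p]).

Lemma fiber_compl_stab p (h : Stab phi p) x :
  fiber_compl p x -> fiber_compl p (psi (val h) x).
Proof.
move=> xp /= e; apply: xp; apply: (can_inj (hactK phi (val h))).
by rewrite -pi_equivariant e stabP.
Qed.

Definition fiber_compl_act p : haction (Stab phi p) (fiber_compl p) :=
  restr_act (@fiber_compl_stab p).

End Complements.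

(* Main.v *)
From mathcomp Require Import all_boot.
From mathcomp Require Import all_classical.
From mathcomp Require Import topology_structure compact subtype_topology.
From mathcomp Require Import separation_axioms.
From mathcomp Require Import product_topology discrete_topology function_spaces.
From mathcomp Require Import subspace_topology initial_topology supremum_topology.
(* Last, because all_classical also exports a constant named [glue]. *)
Require Import Defs.

(** Work with null families instead of entourages: a family of subsets of a
    compact Hausdorff space is eventually small iff, for any disjoint closed E and
    F, only finitely many members meet both.

    If X satisfies (1), the remainder over p is the fiber of p, and the boundary of
    A in Stab p is the trace on the fiber of the closure of A x0, for some x0 off
    the fiber. The map X -> X_q is then continuous because, by perspectivity, a
    limit of the translates k K (k in A) lying over q is also a limit of the k x1.
    The resulting map into the inverse limit is a continuous bijection from a
    compact space to a Hausdorff one.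

    Conversely, let X be a blowup. Two points of X with the same image in Z are
    separated by some coordinate X_q, so by compactness disjoint closed E and F are
    separated by finitely many coordinates and Z, and only the fibers over these
    finitely many q can meet both. For perspectivity at p, cut E and F down
    to a neighborhood of the fiber of p on which their images in X_p are disjoint,
    and use that X_p is perspective. *)

Set Implicit Arguments.
Unset Strict Implicit.
Unset Printing Implicit Defensive.

Local Open Scope classical_set_scope.

(** * Compactness arguments and separation by closed sets *)

(** The sets [B] such that [K] minus [B] satisfies [Q] form a filter [F] containing [K]. If [F] were
    proper it would cluster at some [x] in [K], yet it contains the complement of a neighborhood [N]
    of [x]. Hence [F] contains [set0], which means [Q K]. *)
Lemma compact_ind (X : topologicalType) (K : set X) (Q : set X -> Prop) :
  compact K -> Q set0 ->
  (forall A B, A `<=` B -> Q B -> Q A) ->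
  (forall A B, Q A -> Q B -> Q (A `|` B)) ->
  (forall x, K x -> exists2 N, nbhs x N & Q N) ->
  Q K.
Proof.
move=> cK Q0 QS QU Qloc.
pose F : set_system X := [set B | Q (K `&` ~` B)].
have FF : Filter F.
  split; first by rewrite /F /= setCT setI0.
  - by move=> A B QA QB; rewrite /F /= setCI setIUr; exact: QU.
  - by move=> A B AB; apply: QS; apply: setIS; exact: subsetC.
have [F0|nF0] := pselect (F set0); first by move: F0; rewrite /F /= setC0 setIT.
have PF : ProperFilter F by [].
have FK : F K by rewrite /F /= setICr.
have [x [Kx clx]] := cK F PF FK.
have [N Nx QN] := Qloc x Kx.
have FN : F (~` N).
  by rewrite /F /= setCK; apply: QS QN; exact: subIsetr.
by have [y []] := clx _ _ FN Nx.
Qed.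

Lemma closed_nbhs_shrink (X : topologicalType) :
  compact [set: X] -> hausdorff_space X -> forall (x : X) U, nbhs x U ->
  exists N, [/\ closed N, nbhs x N & N `<=` U].
Proof.
move=> cX hX x U Ux; have nT : nbhs x [set: X] by exact: filterT.
have [W Wx WU] := compact_regular hX cX nT Ux.
exists (closure W); split=> //; first exact: closed_closure.
by apply: filterS Wx; exact: subset_closure.
Qed.

Lemma closed_nbhs_separation (X : topologicalType) :
  compact [set: X] -> hausdorff_space X -> forall x y : X, x <> y ->
  exists E F, [/\ closed E, closed F, nbhs x E, nbhs y F & E `&` F = set0].
Proof.
move=> cX hX x y xy.
have := hX; rewrite open_hausdorff => /(_ x y) [|[U V] /= []].
  exact/eqP.
rewrite !inE => Ux Vy [oU oV UV0].
have [E [cE Ex EU]] := closed_nbhs_shrink cX hX (open_nbhs_nbhs (conj oU Ux)).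
have [F [cF Fy FV]] := closed_nbhs_shrink cX hX (open_nbhs_nbhs (conj oV Vy)).
exists E, F; split=> //; exact: subsetI_eq0 EU FV UV0.
Qed.

Lemma closed_nbhs_avoiding (X : topologicalType) :
  compact [set: X] -> hausdorff_space X -> forall (E : set X) x, closed E -> ~ E x ->
  exists N, [/\ closed N, nbhs x N & N `&` E = set0].
Proof.
move=> cX hX E x cE nEx.
have nE : nbhs x (~` E) by apply: open_nbhs_nbhs; split=> //; exact: closed_openC.
have [N [cN Nx NE]] := closed_nbhs_shrink cX hX nE.
by exists N; split=> //; apply/disjoints_subset.
Qed.

(** * The uniformity of a compact Hausdorff space *)

Section NeighborhoodsOfTheDiagonal.
Variable X : topologicalType.

Lemma entourage_nbhs_diagonal (u : set (X * X)) (x : X) :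
  is_entourage u -> nbhs (x, x) u.
Proof.
move=> [ent [fent dent ient sent nent] eu].
have [v ev vu] := sent u eu.
have nx w : ent w -> nbhs x (xsection w x) by move=> ew; rewrite nent; exists w.
exists (xsection (v^-1)%relation x, xsection v x).
  by split; apply: nx => //; exact: ient.
move=> [y z] [/= /xsectionP yx /xsectionP xz]; apply: vu; exists x => //=.
Qed.

Hypotheses (cX : compact [set: X]) (hX : hausdorff_space X).

Lemma nbhs_diagonal_disjoint (E F : set X) : closed E -> closed F ->
  E `&` F = set0 -> forall x : X, nbhs (x, x) (~` (E `*` F)).
Proof.
move=> cE cF EF0 x; have [Ex|nEx] := pselect (E x).
  have nFx : ~ F x by move=> Fx; have : (E `&` F) x by []; rewrite EF0.
  exists (setT, ~` F); last by move=> [y z] [/= _ nFz] [].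
  split; first exact: filterT.
  by apply: open_nbhs_nbhs; split=> //; exact: closed_openC.
exists (~` E, setT); last by move=> [y z] [/= nEy _] [].
split; last exact: filterT.
by apply: open_nbhs_nbhs; split=> //; exact: closed_openC.
Qed.

(** The splitting axiom comes from compactness of the cube of [X], the neighborhood axiom from
    separation of points. The purpose is to obtain as entourages the complements of products of
    disjoint closed sets. *)
Lemma nbhs_diagonal_uniformity :
  compatible_uniformity [set u : set (X * X) | forall x : X, nbhs (x, x) u].
Proof.
split.
- split=> /=.
  + by move=> x; exact: filterT.
  + by move=> A B HA HB x; exact: filterI.
  + by move=> A B AB HA x; apply: filterS AB _.
- by move=> u ux [x y]; rewrite /diagonal /= => ->; exact: nbhs_singleton.
- move=> u /= ux x; have [[A B] [/= Ax Bx] AB] := ux x.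
  by exists (B, A) => // -[y z] [/= By Az]; apply: AB.
- move=> u ux.
  (* [Q B] provides one [v] that works for all triples in [B]. Near a triple with two distinct
     consecutive entries, a [v] missing a box around that pair makes the assumption fail; near
     [(x, x, x)] the outer pair already lies in [u]. *)
  pose Q (B : set (X * X * X)) := exists2 v : set (X * X),
    (forall x : X, nbhs (x, x) v) &
    forall w, B w -> v (w.1.1, w.1.2) -> v (w.1.2, w.2) -> u (w.1.1, w.2).
  suff [v vx vu] : Q setT.
    by exists v => // -[x z] [y /= xy yz]; exact: (vu (x, y, z)).
  apply: compact_ind.
  + by rewrite -!setXTT; do 2?apply: compact_setX.
  + by exists setT => // x; exact: filterT.
  + by move=> A B AB [v vx vu]; exists v => // w /AB; exact: vu.
  + move=> A B [v vx vu] [v' vx' vu']; exists (v `&` v').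
      by move=> x; exact: filterI.
    by move=> w [Aw|Bw] [? ?] [? ?]; [exact: vu|exact: vu'].
  move=> [[x y] z] _; have [xy|xy] := pselect (x = y); last first.
    have [E [F [cE cF Ex Fy EF]]] := closed_nbhs_separation cX hX xy.
    exists (fst @^-1` (E `*` F)).
      exists (E `*` F, setT) => /=; last by move=> ? [].
      by split; [exists (E, F)|exact: filterT].
    exists (~` (E `*` F)); first exact: nbhs_diagonal_disjoint.
    by move=> [[a b] c] /= ab nab; case: nab.
  have [yz|yz] := pselect (y = z); last first.
    have [E [F [cE cF Ey Fz EF]]] := closed_nbhs_separation cX hX yz.
    exists [set w | E w.1.2 /\ F w.2].
      exists (setT `*` E, F) => /=; last by move=> w [[]].
      by split=> //; exists (setT, E) => //; split=> //; exact: filterT.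
    exists (~` (E `*` F)); first exact: nbhs_diagonal_disjoint.
    by move=> [[a b] c] /= bc _ nbc; case: nbc.
  exists [set w | u (w.1.1, w.2)]; last by exists setT => // ?; exact: filterT.
  have [[A B] [/= Ax Bx] AB] := ux x; subst y z.
  exists (A `*` setT, B) => /=; last first.
    by move=> [[a b] c] [[/= Aa _] Bc]; apply: AB.
  by split=> //; exists (A, setT) => //; split=> //; exact: filterT.
move=> x; apply/seteqP; split=> A.
  (* This set constrains only the pairs starting at [x], and near [(y, y)] with [y <> x] there are
     none. *)
  move=> xA; exists [set yz | yz.1 = x -> A yz.2]; last first.
    by move=> y /xsectionP /=; exact.
  move=> y; have [->|yx] := pselect (y = x).
    exists (setT, A); first by split=> //; exact: filterT.
    by move=> [a b] [/= _ Ab].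
  have [E [F [cE cF Ex Fy EF]]] := closed_nbhs_separation cX hX yx.
  exists (E, setT); first by split=> //; exact: filterT.
  move=> [a b] [/= Ea _] ax; have : (E `&` F) x; last by rewrite EF.
  by split; [rewrite -ax | exact: nbhs_singleton].
move=> [u /= ux uA]; have [[B C] [/= Bx Cx] BC] := ux x.
apply: filterS Cx => y Cy; apply: uA; apply/xsectionP; apply: BC.
by split=> //=; exact: nbhs_singleton.
Qed.

Lemma entourage_disjoint (E F : set X) : closed E -> closed F ->
  E `&` F = set0 -> is_entourage (~` (E `*` F)).
Proof.
move=> cE cF EF; eexists; first exact: nbhs_diagonal_uniformity.
exact: nbhs_diagonal_disjoint.
Qed.

End NeighborhoodsOfTheDiagonal.

(** * Null families *)

Definition null_family (X : topologicalType) (I : Type) (A : I -> set X) :=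
  forall E F, closed E -> closed F -> E `&` F = set0 ->
    finite_set [set i | A i `&` E !=set0 /\ A i `&` F !=set0].

Section NullFamilies.
Variables (X : topologicalType) (cX : compact [set: X]) (hX : hausdorff_space X).

(** Forward, compactness of the square of [X] localizes the pairs outside [u]: near the diagonal
    there are none, and near [(x, y)] with [x <> y] they lie in a box [E * F] controlled by nullity.
    Conversely, a member meeting [E] and [F] is not small for the complement of [E * F]. *)
Lemma null_familyP (I : Type) (A : I -> set X) :
  null_family A <->
  forall u, is_entourage u -> finite_set [set i | ~ small u (A i)].
Proof.
split=> [nA u eu|nA E F cE cF EF]; last first.
  apply: sub_finite_set (nA _ (entourage_disjoint cX hX cE cF EF)).
  move=> i [[x [Ax Ex]] [y [Ay Fy]]] /(_ (x, y)); exact.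
pose Q (B : set (X * X)) := finite_set [set i | exists x y,
  [/\ A i x, A i y, B (x, y) & ~ u (x, y)]].
suff QT : Q setT.
  apply: sub_finite_set QT => i /= /existsNP[[x y]].
  by move=> /not_implyP[[/= Ax Ay] nu]; exists x, y.
apply: compact_ind.
- by rewrite -setXTT; apply: compact_setX.
- by rewrite /Q; apply: sub_finite_set (finite_set0 I) => i [x [y []]].
- move=> B C BC; apply: sub_finite_set => i [x [y [? ? /BC ? ?]]].
  by exists x, y.
- move=> B C QB QC; apply: sub_finite_set (_ : finite_set (_ `|` _)); last first.
    by rewrite finite_setU; split; [exact: QB|exact: QC].
  by move=> i [x [y [? ? [?|?] ?]]]; [left|right]; exists x, y.
move=> [x y] _; have [<-|xy] := pselect (x = y).
  exists u; first exact: entourage_nbhs_diagonal.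
  by rewrite /Q; apply: sub_finite_set (finite_set0 I) => i [a [b []]].
have [E [F [cE cF Ex Fy EF]]] := closed_nbhs_separation cX hX xy.
exists (E `*` F); first by exists (E, F).
apply: sub_finite_set (nA E F cE cF EF) => i [a [b [? ? [/= ? ?] _]]].
by split; [exists a|exists b].
Qed.

(** Let [N] be a closed neighborhood of [c] missing [E]. Every member meets [E], so by nullity only
    finitely many meet [N]; their union is closed and misses [c], which therefore is no limit. Thus
    a limit of the members lying on none of them is a limit of every choice of one point from
    each. *)
Lemma null_family_shadow (I : choiceType) (A : I -> set X) (S : set I) (E : set X) c :
  null_family A -> (forall i, S i -> closed (A i)) -> closed E ->
  (forall i, S i -> A i `&` E !=set0) ->
  closure (\bigcup_(i in S) A i) c -> (forall i, S i -> ~ A i c) -> E c.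
Proof.
move=> nA clA cE meet clc nAc; apply: contrapT => nEc.
have [N [cN Nc NE]] := closed_nbhs_avoiding cX hX cE nEc.
pose J := [set i | A i `&` N !=set0 /\ A i `&` E !=set0].
have fJ : finite_set J by exact: nA.
have clU : closed (\bigcup_(i in J `&` S) A i).
  apply: closed_bigcup; first exact: finite_setIl.
  by move=> i [_ Si]; exact: clA.
have : nbhs c (N `&` ~` \bigcup_(i in J `&` S) A i).
  apply: filterI => //; apply: open_nbhs_nbhs; split; first exact: closed_openC.
  by move=> [i [_ Si]]; exact: nAc.
move=> /clc[y [[i Si Ay] [Ny nU]]]; apply: nU; exists i => //.
by split=> //; split; [exists y|exact: meet].
Qed.

End NullFamilies.

(** * Glued spaces *)

(** Pass to the complements of separating open sets. This form suits glued spaces, whose topology is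
    given by closed sets. *)
Lemma hausdorff_closed_coverP (X : topologicalType) :
  hausdorff_space X <-> forall x y : X, x <> y ->
  exists E F, [/\ closed E, closed F, E `|` F = setT, ~ F x & ~ E y].
Proof.
rewrite open_hausdorff; split=> hX x y xy.
  have [|[U V] /= []] := hX x y; first exact/eqP.
  rewrite !inE => Ux Vy [oU oV UV].
  exists (~` V), (~` U); split; try exact: open_closedC; try by move/(_ _).
  by rewrite -setCI setIC UV setC0.
have [|E [F [cE cF EF nFx nEy]]] := hX x y; first exact/eqP.
exists (~` F, ~` E); first by rewrite !inE.
split=> /=; try exact: closed_openC.
by apply/eqP; rewrite -setCU setUC EF setCT.
Qed.

Section GlueSpaces.
Variables (V C : topologicalType) (f : gluing_map V C).

Definition glue_set (S : set V) (E : set C) : set (glue f) :=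
  [set y | match y with inl v => S v | inr c => E c end].

Lemma glue_set_closed S E : closed S -> closed E -> f S `<=` E ->
  closed (glue_set S E).
Proof. by move=> cS cE fSE; apply/glue_closedP. Qed.

Lemma glue_inl_continuous : continuous (glue_inl f).
Proof. by apply/continuous_closedP => B /glue_closedP[]. Qed.

Lemma glue_inr_continuous : continuous (glue_inr f).
Proof. by apply/continuous_closedP => B /glue_closedP[]. Qed.

Lemma setC_range_glue_inl : ~` range (glue_inl f) = range (glue_inr f).
Proof.
apply/seteqP; split=> [[v|c] nr|_ [c _ <-] [v _]] //.
by case: nr; exists v.
Qed.

Lemma glue_inl_open_embedding : open_embedding (glue_inl f).
Proof.
split; [by move=> v w [] | exact: glue_inl_continuous | move=> A oA].
have -> : glue_inl f @` A = ~` glue_set (~` A) setT.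
  apply/seteqP; split=> [_ [v Av <-]|[v|c]] /=; first exact.
    by move/contrapT => Av; exists v.
  by case.
by apply: closed_openC; apply: glue_set_closed => //; exact: open_closedC.
Qed.

(** Two points of [V] are separated inside [V]; a point of [V] is cut off from [C] by a closed
    neighborhood with empty boundary; for two points of [C], a closed cover of [C] and one of [V]
    are combined. *)
Lemma glue_hausdorff :
  hausdorff_space V -> hausdorff_space C ->
  (forall v : V, exists N, [/\ closed N, nbhs v N & f N = set0]) ->
  (forall c c', c <> c' -> exists S S',
    [/\ closed S, closed S', S `|` S' = setT, ~ f S c' & ~ f S' c]) ->
  hausdorff_space (glue f).
Proof.
move=> hV hC locV sepC; apply/hausdorff_closed_coverP.
have sep_inl_inr v c : exists E F, [/\ closed E, closed F, E `|` F = setT,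
    ~ F (glue_inl f v) & ~ E (glue_inr f c)].
  have [N [cN vN fN]] := locV v.
  exists (glue_set N set0), (glue_set (~` N°) setT); split.
  - by apply: glue_set_closed => //; [exact: closed0 | rewrite fN].
  - by apply: glue_set_closed => //; apply: open_closedC; exact: open_interior.
  - rewrite -subTset => -[w|d] _; last by right.
    have [Nw|nNw] := pselect (N w); first by left.
    by right=> /= /interior_subset.
  - by move=> /= /(_ vN).
  - by case.
move=> [v|c] [v'|c'] ne.
- have [|E [F [cE cF EF nF nE]]] := (hausdorff_closed_coverP V).1 hV v v'.
    by move=> e; apply: ne; rewrite e.
  exists (glue_set E setT), (glue_set F setT).
  split=> //; try exact: glue_set_closed.
  rewrite -subTset => -[w|d] _; last by left.
  by have : (E `|` F) w by rewrite EF.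
- exact: sep_inl_inr.
- have [E [F [cE cF EF nF nE]]] := sep_inl_inr v' c.
  by exists F, E; split=> //; rewrite setUC.
have {}ne : c <> c' by move=> e; apply: ne; rewrite e.
have [E [F [cE cF EF nF nE]]] := (hausdorff_closed_coverP C).1 hC c c' ne.
have [S [S' [cS cS' SS' nS nS']]] := sepC c c' ne.
(* Adding [f S] to [E] makes the set closed without capturing [c'], which [f S] misses; likewise for
   [S'] and [c]. *)
exists (glue_set S (E `|` f S)), (glue_set S' (F `|` f S')); split.
- apply: glue_set_closed => //.
  by apply: closedU => //; exact: gluing_closed.
- apply: glue_set_closed => //.
  by apply: closedU => //; exact: gluing_closed.
- rewrite -subTset => -[w|d] _ /=.
    by have : (S `|` S') w by rewrite SS'.
  have [|] : (E `|` F) d by rewrite EF.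
    by left; left.
  by right; left.
- by case.
- by case.
Qed.

(** If the filter [F] has no cluster point, compactness of [C] yields one [A] in [F] whose closure
    misses [C]. The trace of this closure on [V] has empty boundary, so it is compact, and its image
    belongs to [F]: this gives a cluster point after all. *)
Lemma glue_compact :
  compact [set: C] ->
  (forall S, closed S -> f S = set0 -> compact S) ->
  compact [set: glue f].
Proof.
move=> cC cV F PF _; apply: contrapT => ncl.
have [A FA AC] : exists2 A, F A & range (glue_inr f) `&` closure A = set0.
  pose Q (B : set (glue f)) := exists2 A, F A & B `&` closure A = set0.
  apply: (@compact_ind _ _ Q).
  - apply: continuous_compact => //.
    by apply: continuous_subspaceT; exact: glue_inr_continuous.
  - by exists setT; [exact: filterT | rewrite set0I].
  - move=> B B' BB' [A FA BA]; exists A => //.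
    by rewrite -subset0 -BA; exact: setSI.
  - move=> B B' [A FA BA] [A' FA' BA']; exists (A `&` A'); first exact: filterI.
    rewrite -subset0 setIUl => x [|] [Bx /closureI[Ax A'x]].
      by rewrite -BA.
    by rewrite -BA'.
  move=> _ [c _ <-]; have : ~ cluster F (glue_inr f c).
    by move=> clc; apply: ncl; exists (glue_inr f c).
  rewrite clusterE => /existsNP[A] /not_implyP[FA nAc].
  exists (~` closure A).
    by apply: open_nbhs_nbhs; split=> //; apply: closed_openC; exact: closed_closure.
  by exists A => //; rewrite setICl.
pose S := glue_inl f @^-1` closure A.
have clA := (glue_closedP (closure A)).1 (@closed_closure _ A).
have fS : f S = set0.
  rewrite -subset0 => c fSc.
  have : (range (glue_inr f) `&` closure A) (glue_inr f c); last by rewrite AC.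
  by split; [exists c | have [_ _] := clA; apply].
have cS : compact (glue_inl f @` S).
  apply: continuous_compact; last by apply: cV => //; have [] := clA.
  by apply: continuous_subspaceT; exact: glue_inl_continuous.
have [|y [_ cly]] := cS F PF; last by apply: ncl; exists y.
apply: filterS FA => -[v|c] Ay; first by exists v => //; exact: subset_closure.
have : (range (glue_inr f) `&` closure A) (glue_inr f c).
  by split; [exists c | exact: subset_closure].
by rewrite AC.
Qed.

Lemma gluing_finite_bigcup_subset (I : choiceType) (J : set I) (A : I -> set V) E :
  finite_set J -> (forall i, J i -> closed (A i)) -> (forall i, J i -> f (A i) `<=` E) ->
  f (\bigcup_(i in J) A i) `<=` E.
Proof.
move=> /finite_seqP[s ->] cA fA; rewrite bigcup_seq.
suff [] : closed (\big[setU/set0]_(i <- s) A i) /\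
          f (\big[setU/set0]_(i <- s) A i) `<=` E by [].
rewrite big_seq; elim/big_ind : _ => [|B B' [cB fB] [cB' fB']|i si].
- by split; [exact: closed0 | rewrite gluing0].
- by split; [exact: closedU | rewrite gluingU// subUset].
- by split; [exact: cA | exact: fA].
Qed.

End GlueSpaces.

Arguments glue_set {V C} f S E.

(** * Perspective compactifications of a group *)

(* The properties of [bd] that make [glue bd] an element of EPers(H): they only
   speak of subsets of [H], hence pass through group isomorphisms and through
   the operation Pi without any compactness argument. *)
Record perspective_boundary (H : groupType) (C : topologicalType)
    (bd : gluing_map (discrete_topology H) C) : Prop := PerspectiveBoundary {
  pb_hausdorff : hausdorff_space C;
  pb_finite : forall A : set H, finite_set A -> bd A = set0;
  pb_empty_finite : forall A : set H, bd A = set0 -> finite_set A;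
  pb_translate : forall (A : set H) g, bd [set (h * g)%g | h in A] `<=` bd A;
  pb_separated : forall c c', c <> c' ->
    exists A : set H, ~ bd A c' /\ ~ bd (~` A) c }.

Section PerspectiveBoundaryTransfer.
Variables (H : groupType) (V C : topologicalType).
Variables (bd : gluing_map (discrete_topology H) C) (a : haction H V) (K : set V).

(** [bd (hitting S)] is the Pi boundary of [S]. Through the hypothesis [f_hitting], the section
    applies both to [Pi_gluing] over a punctured space and to [bd] itself, with [H] acting on itself
    and [K] the identity alone. *)
Definition hitting (S : set V) : set H := [set h | (a h @` K) `&` S !=set0].

Definition sweep (B : set H) : set V := \bigcup_(h in B) (a h @` K).

Variable f : gluing_map V C.
Hypotheses (pbd : perspective_boundary bd) (hV : hausdorff_space V).
Hypothesis V_locally_compact : forall v : V, exists2 N, compact N & nbhs v N.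
Hypotheses (a_pd : properly_discontinuous a) (cK : compact K).
Hypothesis a_cover : translates_cover a K.
Hypothesis f_hitting : forall S, closed S -> f S = bd (hitting S).

Let bdS (A B : set H) : A `<=` B -> bd A `<=` bd B.
Proof. by apply: (@gluingS _ _ bd A B); exact: discrete_closed. Qed.

Lemma hitting_finite N : compact N -> finite_set (hitting N).
Proof.
move=> cN; apply: sub_finite_set (a_pd (compactU cK cN)) => h [_ [[k Kk <-] Nk]].
by exists (a h k); split; [exists k => //; left | right].
Qed.

Lemma act_compact h L : compact L -> compact (a h @` L).
Proof.
move=> cL; apply: continuous_compact => //; apply: continuous_subspaceT.
exact: haction_continuous (hactionP a) h.
Qed.

(** By proper discontinuity the translates of [K] form a locally finite family of closed sets. *)
Lemma sweep_closed B : closed (sweep B).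
Proof.
move=> v clv; have [N cN vN] := V_locally_compact v.
have cl : closed (\bigcup_(h in B `&` hitting N) (a h @` K)).
  apply: closed_bigcup; first by apply: finite_setIr; exact: hitting_finite.
  by move=> h _; apply: compact_closed => //; exact: act_compact.
apply: contrapT => nv.
have : nbhs v (N `&` ~` \bigcup_(h in B `&` hitting N) (a h @` K)).
  apply: filterI => //; apply: open_nbhs_nbhs; split; first exact: closed_openC.
  by move=> [h [Bh _] ahv]; apply: nv; exists h.
move=> /clv[w [[h Bh ahw] [Nw nw]]]; apply: nw; exists h => //.
by split=> //; exists w.
Qed.

(** If [h K] meets [b K], then [b^-1 * h] lies in the finite set [hitting K]. So [hitting (sweep B)]
    is covered by finitely many right translates of [B], and right translation does not enlarge the
    boundary. *)
Lemma gluing_sweep B : f (sweep B) `<=` bd B.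
Proof.
rewrite (f_hitting (@sweep_closed B)).
have sub : hitting (sweep B) `<=`
    \bigcup_(g in hitting K) [set (h * g)%g | h in B].
  move=> h [_ [[k Kk <-] [b Bb [k' Kk' bk']]]].
  exists (b^-1 * h)%g; last by exists b => //; rewrite mulVKg.
  exists k'; split=> //; exists k => //.
  by rewrite (hactionM (hactionP a)) -bk' -(hactionM (hactionP a)) mulVg
    (haction1 (hactionP a)).
apply: subset_trans (bdS sub) _.
apply: gluing_finite_bigcup_subset; first exact: hitting_finite.
  by move=> *; exact: discrete_closed.
by move=> g _; exact: pb_translate.
Qed.

Lemma perspective_glue_hausdorff : hausdorff_space (glue f).
Proof.
apply: glue_hausdorff => //; first exact: pb_hausdorff pbd.
  move=> v; have [N cN vN] := V_locally_compact v.
  have cN' := compact_closed hV cN.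
  exists N; split=> //; rewrite f_hitting //; apply: pb_finite => //.
  exact: hitting_finite.
move=> c c' /(pb_separated pbd)[A [nA nA']].
(* Sweeping [A] and its complement turns the separation in [H] into a closed cover of [V]. *)
exists (sweep A), (sweep (~` A)); split; try exact: sweep_closed.
- rewrite -subTset => v _; have [h [k Kk <-]] := a_cover v.
  by have [Ah|nAh] := pselect (A h); [left|right]; exists h.
- by move/gluing_sweep.
- by move/gluing_sweep.
Qed.

(** Finitely many translates [g K] cover [L]. So if [h L] meets [E] and [F], then [h g] hits [S] and
    [h g'] hits [S'] for one of finitely many pairs [(g, g')]. For a fixed pair, the boundary of the
    set of such [h] lies in both [E] and [F]; it is empty, and the set is finite. *)
Lemma perspective_glue_null L :
  compact L -> null_family (fun h => glue_inl f @` (a h @` L)).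
Proof.
move=> cL E F /glue_closedP[cE _ fE] /glue_closedP[cF _ fF] EF.
set S := _ @^-1` E in cE fE; set S' := _ @^-1` F in cF fF.
rewrite !f_hitting // in fE fF.
pose M (gg : H * H) := [set h : H | hitting S (h * gg.1)%g /\ hitting S' (h * gg.2)%g].
have cut T h : (glue_inl f @` (a h @` L)) `&` T !=set0 ->
    exists2 g, hitting L g & hitting (glue_inl f @^-1` T) (h * g)%g.
  move=> [_ [[_ [l Ll <-] <-] Tl]]; have [g [k Kk gk]] := a_cover l.
  exists g; first by exists l; split=> //; exists k.
  exists (a h l); split=> //; exists k => //.
  by rewrite (hactionM (hactionP a)) gk.
apply: (@sub_finite_set _ _ (\bigcup_(gg in hitting L `*` hitting L) M gg)).
  move=> h [/cut[g Lg Eg] /cut[g' Lg' Fg']].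
  by exists (g, g').
apply: bigcup_finite => [|[g g'] _].
  by apply: finite_setX; exact: hitting_finite.
apply: (pb_empty_finite pbd).
(* [A] is the right translate of [A g0] by [g0^-1], so its boundary is contained in that of
   [A g0]. *)
have back (A B : set H) g0 : (forall h, A h -> B (h * g0)%g) -> bd A `<=` bd B.
  move=> AB; have sub : [set (h * g0)%g | h in A] `<=` B.
    by move=> _ [h Ah <-]; exact: AB.
  apply: subset_trans _ (bdS sub).
  have {1}-> : A = [set (h * g0^-1)%g | h in [set (h * g0)%g | h in A]].
    apply/seteqP; split=> [h Ah|_ [_ [h Ah <-] <-]]; last by rewrite mulgK.
    by exists (h * g0)%g; [exists h | rewrite mulgK].
  exact: pb_translate.
rewrite -subset0 => c cM.
have : (E `&` F) (glue_inr f c); last by rewrite EF.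
split.
  by apply: fE; apply: back cM => h [Sh _]; exact: Sh.
by apply: fF; apply: back cM => h [_ Sh]; exact: Sh.
Qed.

End PerspectiveBoundaryTransfer.

Lemma hausdorff_injective (X Y : topologicalType) (g : X -> Y) :
  continuous g -> injective g -> hausdorff_space Y -> hausdorff_space X.
Proof.
move=> /continuous_closedP cg ig hY; apply/hausdorff_closed_coverP => x y xy.
have [|E [F [cE cF EF nF nE]]] := (hausdorff_closed_coverP Y).1 hY (g x) (g y).
  by move/ig.
exists (g @^-1` E), (g @^-1` F); split=> //; try exact: cg.
by rewrite -preimage_setU EF.
Qed.

Lemma finite_closed (X : topologicalType) (A : set X) :
  hausdorff_space X -> finite_set A -> closed A.
Proof. by move=> hX /finite_compact; exact: compact_closed. Qed.

Section GroupCompactifications.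
Variables (H : groupType) (C : topologicalType).
Variable bd : gluing_map (discrete_topology H) C.

Lemma discrete_compact_finite (A : set (discrete_topology H)) :
  compact A -> finite_set A.
Proof.
move=> cA; apply: (compact_ind cA) => [|B B'|B B' fB fB'|h _].
- exact: finite_set0.
- exact: sub_finite_set.
- by rewrite finite_setU.
- by exists [set h]; [exact: discrete_set1 | exact: finite_set1].
Qed.

(** Perspectivity is applied to the two-point sets [{1, g}]: the pairs [{h, h g}] form a null
    family, so [A] and [A g] have the same limits. The other properties come from [glue bd] being
    compact Hausdorff with [H] open and discrete in it. *)
Lemma EPers_perspective_boundary (w : H -> glue bd -> glue bd) :
  EPers (lmul H) (glue_inl bd) w -> perspective_boundary bd.
Proof.
move=> [cY hY _ _ _ wE _ persp].
have nul (g : H) : null_family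
    (fun h => w h @` (glue_inl bd @` [set (1%g : H); g])).
  apply/(null_familyP cY hY) => u eu; apply: persp => //.
  exact/finite_compact/finite_set2.
split.
- apply: (@hausdorff_injective _ _ (glue_inr bd)) hY; last by move=> c c' [].
  exact: glue_inr_continuous.
- move=> A fA; rewrite -glue_closure; last exact: discrete_closed.
  rewrite -(closure_id _).1; last by apply: finite_closed => //; exact: finite_image.
  by rewrite -subset0 => c [].
(* With empty boundary, [A] is closed in the compact space [glue bd]; its points being open, it is
   finite. *)
- move=> A bA; have clA : closed (glue_set bd A set0).
    by apply: glue_set_closed; [exact: discrete_closed|exact: closed0|rewrite bA].
  have cA := subclosed_compact clA cY (@subsetT _ _).
  pose Q (B : set (glue bd)) := finite_set (glue_inl bd @^-1` B).
  have : Q (glue_set bd A set0); last exact: sub_finite_set.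
  apply: (compact_ind cA) => [|B B' BB'|B B' fB fB'|[h|c] // Ah].
  + by rewrite /Q preimage_set0; exact: finite_set0.
  + by apply: sub_finite_set => h; exact: BB'.
  + by rewrite /Q preimage_setU finite_setU.
  exists (glue_inl bd @` [set h]).
    apply: open_nbhs_nbhs; split; last by exists h.
    by have [_ _] := glue_inl_open_embedding bd; apply; exact: discrete_open.
  apply: sub_finite_set (finite_set1 h) => x [_ -> [->]] //.
- move=> A g c cg.
  have cl_inr (B : set (discrete_topology H)) d :
      bd B d <-> closure (glue_inl bd @` B) (glue_inr bd d).
    by rewrite -(glue_closure bd (discrete_closed B)).
  apply/cl_inr; apply: (null_family_shadow (S := A) cY hY (nul g)).
  + move=> h _; apply: finite_closed => //.
    by do 2 apply: finite_image; exact: finite_set2.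
  + exact: closed_closure.
  + move=> h Ah; exists (glue_inl bd h); split.
      exists (glue_inl bd 1%g); first by exists 1%g => //; left.
      by rewrite wE /= /lmul_fun mulg1.
    by apply: subset_closure; exists h.
  + apply: closureS ((cl_inr _ _).1 cg) => _ [_ [h Ah <-] <-].
    exists h => //; exists (glue_inl bd g); last by rewrite wE.
    by exists g => //; right.
  + by move=> h _ [_ [x _ <-]]; rewrite wE.
move=> c c' cc'.
have [|E [F [/glue_closedP[_ _ bE] /glue_closedP[_ _ bF] EF nF nE]]] :=
    (hausdorff_closed_coverP _).1 hY (glue_inr bd c) (glue_inr bd c').
  by move=> [].
exists (glue_inl bd @^-1` E); split; first by move/bE.
have sub : ~` (glue_inl bd @^-1` E) `<=` glue_inl bd @^-1` F.
  by move=> h nEh; have [] : (E `|` F) (glue_inl bd h) by rewrite EF.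
by move/(gluingS (discrete_closed _) (discrete_closed _) sub)/bF.
Qed.

Lemma hitting_lmul (S : set H) : hitting (lmul H) [set (1%g : H)] S = S.
Proof.
apply/seteqP; split=> [h [_ [[_ -> <-]]]|h Sh]; first by rewrite /= /lmul_fun mulg1.
by exists h; split=> //; exists 1%g => //=; rewrite /lmul_fun mulg1.
Qed.

(** Left multiplication is the case where [K] is the identity alone and [hitting] does nothing, so
    separation and nullity come from the transfer to glued spaces. Equivariance of [bd] serves the
    continuity of the extended action. *)
Lemma perspective_boundary_EPers (e : haction H C) :
  perspective_boundary bd -> compact [set: C] ->
  (forall h (A : set H) c, bd A c -> bd [set (h * x)%g | x in A] (e h c)) ->
  EPers (lmul H) (glue_inl bd) (sum_act (lmul H) e).
Proof.
move=> pbd cC equi.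
have hH : hausdorff_space (discrete_topology H) by exact: discrete_hausdorff.
have lcH (h : discrete_topology H) : exists2 N, compact N & nbhs h N.
  by exists [set h]; [exact: compact_set1 | exact: discrete_set1].
have pdH : properly_discontinuous (lmul H).
  move=> K /discrete_compact_finite fK.
  apply: sub_finite_set (finite_image2 (fun x y : H => (x * y^-1)%g) fK fK).
  move=> h [_ [[k Kk <-] Khk]]; exists (h * k)%g => //; exists k => //.
  by rewrite mulgK.
have c1 : compact [set (1%g : discrete_topology H)] by exact: compact_set1.
have cov : translates_cover (lmul H) [set (1%g : H)].
  by move=> h; exists h, 1%g => //=; rewrite /lmul_fun mulg1.
have bdE (S : set (discrete_topology H)) : closed S ->
    bd S = bd (hitting (lmul H) [set (1%g : H)] S).
  by move=> _; rewrite hitting_lmul.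
have cY : compact [set: glue bd].
  apply: glue_compact => // S _ /(pb_empty_finite pbd) fS; exact: finite_compact.
have hY : hausdorff_space (glue bd).
  exact: perspective_glue_hausdorff pbd hH lcH pdH c1 cov bdE.
split=> //.
- exact: glue_inl_open_embedding.
- rewrite setC_range_glue_inl; apply: continuous_compact => //.
  by apply: continuous_subspaceT; exact: glue_inr_continuous.
- split=> [[h|c]|g h [x|c]|g].
  + by rewrite /= /glue_inl /lmul_fun mul1g.
  + by rewrite /= /glue_inr (haction1 (hactionP e)).
  + by rewrite /= /glue_inl /lmul_fun mulgA.
  + by rewrite /= /glue_inr (hactionM (hactionP e)).
  apply/continuous_closedP => B /glue_closedP[_ B2 B3]; apply/glue_closedP.
  split; first exact: discrete_closed.
    by have /continuous_closedP/(_ _ B2) := @haction_continuous _ _ _ (hactionP e) g.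
  move=> c /(equi g) bc; apply: B3; apply: gluingS bc; try exact: discrete_closed.
  by move=> _ [x Bx <-].
- move=> h y; rewrite setC_range_glue_inl => -[c _ <-]; exists (e h c) => //.
- move=> u K eu cK.
  have nul := perspective_glue_null pbd pdH c1 cov bdE cK.
  apply: sub_finite_set ((null_familyP cY hY _).1 nul u eu) => h /= nsm sm.
  by apply: nsm => -[x y] /= [[_ [k Kk <-] <-] [_ [l Ll <-] <-]]; apply: sm;
    split; [exists (lmul H h k) => //; exists k | exists (lmul H h l) => //; exists l].
Qed.

Lemma perspective_boundary_transport (H' : groupType) (c : H' -> H) (d : H -> H') :
  cancel c d -> cancel d c -> (forall x y, c (x * y)%g = (c x * c y)%g) ->
  perspective_boundary bd -> perspective_boundary (transport_gluing c bd).
Proof.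
move=> cd dc cM [hC fin inf tr sep].
have bdS (A B : set H) : A `<=` B -> bd A `<=` bd B.
  by apply: (@gluingS _ _ bd A B); exact: discrete_closed.
split=> //.
- by move=> A fA; apply: fin; exact: finite_image.
- move=> A /inf fcA; have -> : A = d @` (c @` A).
    apply/seteqP; split=> [x Ax|_ [_ [x Ax <-] <-]]; last by rewrite cd.
    by exists (c x) => //; exists x.
  exact: finite_image.
- move=> A g; apply: subset_trans _ (tr (c @` A) (c g)); apply: bdS.
  by move=> _ [_ [h Ah <-] <-]; exists (c h); [exists h | rewrite cM].
move=> x y /sep[A [nA nA']]; exists (c @^-1` A); split.
  by apply: contra_not nA; apply: bdS => _ [h Ah <-].
by apply: contra_not nA'; apply: bdS => _ [h Ah <-].
Qed.

End GroupCompactifications.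

(** * Products, subspaces and orbit closures *)

Section ProductsAndSubspaces.

Lemma prod_topology_proj_continuous (I : Type) (Y : I -> topologicalType) i :
  continuous (fun g : prod_topology Y => g i).
Proof.
move=> g; have /cvg_sup/(_ i) gi : g --> g by exact: cvg_id.
move=> A /= giA; apply: gi.
exact: (@initial_continuous (forall i, Y i) (Y i) (fun f => f i) g).
Qed.

Lemma continuous_prod_topology (X : topologicalType) (I : Type)
    (Y : I -> topologicalType) (f : X -> prod_topology Y) :
  (forall i, continuous (fun x => f x i)) -> continuous f.
Proof.
move=> fi x; apply/cvg_sup => i.
exact: (@continuous_comp_initial (forall i, Y i) X (Y i) (fun g => g i) f (fi i) x).
Qed.

Lemma val_continuous (X : topologicalType) (A : set X) :
  continuous (val : A -> X).
Proof. exact: initial_continuous. Qed.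

Lemma continuous_set_type (X Y : topologicalType) (A : set Y) (f : X -> A) :
  continuous (fun x => val (f x)) -> continuous f.
Proof. exact: continuous_comp_initial. Qed.

Lemma compact_set_type (X : topologicalType) (A K : set X) :
  compact K -> K `<=` A -> compact (val @^-1` K : set A).
Proof.
move=> cK KA F PF FK.
have [|x [Kx clx]] := cK (fmap (val : A -> X) F) _; first exact: FK.
exists (exist _ x (mem_set (KA x Kx))); split=> // B N FB [O [[U oU <-] Ux] ON].
have [_ [[y By <-] Uy]] : (val @` B) `&` U !=set0.
  apply: clx; last exact: open_nbhs_nbhs.
  suff : F (val @^-1` (val @` B)) by [].
  by apply: filterS FB => y By; exists y.
by exists y; split=> //; exact: ON.
Qed.

Lemma compact_image (X Y : topologicalType) (f : X -> Y) (A : set X) :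
  continuous f -> compact A -> compact (f @` A).
Proof.
by move=> cf; apply: continuous_compact; exact: continuous_subspaceT.
Qed.

Lemma closed_subset_compact (X : topologicalType) (A : set X) :
  compact [set: X] -> closed A -> compact A.
Proof. by move=> cX cA; exact: subclosed_compact cA cX (@subsetT _ _). Qed.

Lemma closure_subset_closed (X : topologicalType) (A E : set X) :
  closed E -> A `<=` E -> closure A `<=` E.
Proof. by move=> cE AE; rewrite closureE; exact: smallest_sub. Qed.

Lemma continuous_closure_image (X Y : topologicalType) (f : X -> Y) (A : set X) x :
  continuous f -> closure A x -> closure (f @` A) (f x).
Proof.
move=> /continuous_closedP cf; move: x.
apply: (@closure_subset_closed _ _ (f @^-1` closure (f @` A))).
  by apply: cf; exact: closed_closure.
by move=> y Ay; apply: subset_closure; exists y.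
Qed.

Lemma compact_hausdorff_homeomorphism (X Y : topologicalType) (f : X -> Y) :
  compact [set: X] -> hausdorff_space Y -> continuous f -> injective f ->
  (forall y, exists x, f x = y) -> homeomorphism f.
Proof.
move=> cX hY cf fI fS; split=> //; have [g gf] := choice fS.
exists g; split=> // [|x]; last by apply: fI; rewrite gf.
apply/continuous_closedP => B cB.
have -> : g @^-1` B = f @` B.
  apply/seteqP; split=> [y By|_ [x Bx <-]]; first by exists (g y).
  by rewrite /preimage /= (_ : g (f x) = x) //; apply: fI; rewrite gf.
by apply: compact_closed => //; apply: compact_image => //; exact: closed_subset_compact.
Qed.

Lemma hausdorff_separating (X : topologicalType) :
  (forall x y : X, x <> y -> exists (Y : topologicalType) (f : X -> Y),
    [/\ hausdorff_space Y, continuous f & f x <> f y]) -> hausdorff_space X.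
Proof.
move=> sep; apply/hausdorff_closed_coverP => x y /sep[Y [f [hY cf fxy]]].
have [E [F [cE cF EF nF nE]]] := (hausdorff_closed_coverP Y).1 hY _ _ fxy.
exists (f @^-1` E), (f @^-1` F); split=> //.
- by have /continuous_closedP := cf; apply.
- by have /continuous_closedP := cf; apply.
- by rewrite -preimage_setU EF.
Qed.

End ProductsAndSubspaces.

Section OrbitBoundary.
Variables (X : topologicalType) (cX : compact [set: X]) (hX : hausdorff_space X).
Variables (H : groupType) (w : haction H X) (L R : set X).
Hypotheses (cL : closed L) (wL : forall h x, L x -> L (w h x)).
Hypothesis w_null : forall K, compact K -> K `&` L = set0 ->
  null_family (fun h => w h @` K).
Hypothesis w_pd : forall K, compact K -> K `&` L = set0 ->
  finite_set [set h | (w h @` K) `&` K !=set0].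
Hypotheses (R1 : is_subset1 R) (RL : R `&` L = set0).
Hypothesis R_empty : R = set0 -> finite_set [set: H].

Lemma subset1_finite : finite_set R.
Proof.
have [->|/set0P[r Rr]] := eqVneq R set0; first exact: finite_set0.
by apply: sub_finite_set (finite_set1 r) => x Rx; exact: R1.
Qed.

(* [R] is a base point, or empty when there is nothing outside [L]. *)
Definition orbit_of (A : set H) : set X := \bigcup_(h in A) (w h @` R).

Definition orbit_boundary_fun (A : set (discrete_topology H)) : set L :=
  val @^-1` closure (orbit_of A).

Lemma orbit_boundary_closed A : closed A -> closed (orbit_boundary_fun A).
Proof.
move=> _; have /continuous_closedP := @val_continuous _ L; apply.
exact: closed_closure.
Qed.

Lemma orbit_boundary0 : orbit_boundary_fun set0 = set0.
Proof.
by rewrite /orbit_boundary_fun /orbit_of bigcup_set0 closure0 preimage_set0.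
Qed.

Lemma orbit_boundaryU A B : closed A -> closed B ->
  orbit_boundary_fun (A `|` B) = orbit_boundary_fun A `|` orbit_boundary_fun B.
Proof.
move=> _ _.
by rewrite /orbit_boundary_fun /orbit_of bigcup_setU closureU preimage_setU.
Qed.

Definition orbit_boundary : gluing_map (discrete_topology H) L :=
  GluingMap orbit_boundary_closed orbit_boundary0 orbit_boundaryU.

Lemma act_outside h x : ~ L x -> ~ L (w h x).
Proof.
move=> nLx /(wL h^-1%g); rewrite -(hactionM (hactionP w)) mulVg.
by rewrite (haction1 (hactionP w)).
Qed.

Lemma outside_L (A : set X) : A `&` L = set0 <-> forall x, A x -> ~ L x.
Proof.
split=> [AL x Ax Lx|AL]; first by have : (A `&` L) x by []; rewrite AL.
by rewrite -subset0 => x [/AL].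
Qed.

Lemma act_image_closed K h : compact K -> closed (w h @` K).
Proof.
move=> cK; apply: compact_closed => //; apply: compact_image => //.
exact: (@haction_continuous _ _ _ (hactionP w)).
Qed.

Lemma orbit_boundary_of_finite (A : set H) : finite_set A -> orbit_boundary A = set0.
Proof.
move=> fA; rewrite -subset0 => -[c Lc]; rewrite /= /orbit_boundary_fun /=.
rewrite -(closure_id _).1.
  move=> [h Ah [r Rr /= rc]]; apply: (@act_outside h r); last first.
    by rewrite rc; exact: set_mem.
  exact: (outside_L R).1 RL _ Rr.
apply: closed_bigcup => // h _; apply: act_image_closed.
exact/finite_compact/subset1_finite.
Qed.

(** If the orbit does not accumulate on [L], its closure together with [R] is a compact set [K] off
    [L], and [h K] meets [K] for every [h] in [A]; proper discontinuity concludes. When [R] is empty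
    the whole group is finite. *)
Lemma orbit_boundary_empty_finite (A : set H) : orbit_boundary A = set0 -> finite_set A.
Proof.
have [R0 _|/set0P[r Rr]] := eqVneq R set0.
  exact: sub_finite_set (@subsetT _ A) (R_empty R0).
move=> A0; pose K := R `|` closure (orbit_of A).
have cK : compact K.
  apply: compactU; first exact/finite_compact/subset1_finite.
  by apply: closed_subset_compact => //; exact: closed_closure.
have KL : K `&` L = set0.
  rewrite /K setIUl RL set0U -subset0 => x [clx Lx].
  have : orbit_boundary A (exist _ x (mem_set Lx)) by [].
  by rewrite A0.
apply: sub_finite_set (w_pd cK KL) => h Ah.
exists (w h r); split; first by exists r => //; left.
by right; apply: subset_closure; exists h => //; exists r.
Qed.

(** With [K'] the union of [K] and [g R], the sets [h K'] form a null family off [L], and each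
    contains the orbit point [h g r]. By [null_family_shadow], a limit in [L] of the translates of
    [K] is a limit of these orbit points. *)
Lemma orbit_boundary_shadow (K : set X) (A : set H) g x :
  R !=set0 -> compact K -> K `&` L = set0 -> L x ->
  closure (\bigcup_(h in A) (w h @` K)) x ->
  closure (orbit_of [set (h * g)%g | h in A]) x.
Proof.
move=> [r Rr] cK KL Lx clx; pose K' := K `|` w g @` R.
have cK' : compact K'.
  apply: compactU => //; apply/finite_compact/finite_image; exact: subset1_finite.
have KL' : K' `&` L = set0.
  apply/outside_L => _ [/((outside_L K).1 KL)//|[y Ry <-]].
  apply: act_outside; exact: (outside_L R).1 RL _ Ry.
apply: (null_family_shadow (S := A) cX hX (w_null cK' KL')).
- by move=> h _; exact: act_image_closed.
- exact: closed_closure.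
- move=> h Ah; exists (w (h * g)%g r); split.
    exists (w g r); first by right; exists r.
    by rewrite (hactionM (hactionP w)).
  by apply: subset_closure; exists (h * g)%g; [exists h | exists r].
- apply: closureS clx => _ [h Ah [k Kk <-]]; exists h => //.
  by exists k => //; left.
- move=> h _ [k K'k whk]; apply: (act_outside (h := h) _ (x := k)).
    exact: (outside_L K').1 KL' _ K'k.
  by rewrite whk.
Qed.

Lemma orbit_boundary_perspective : perspective_boundary orbit_boundary.
Proof.
split.
- exact: hausdorff_injective (@val_continuous _ L) val_inj hX.
- exact: orbit_boundary_of_finite.
- exact: orbit_boundary_empty_finite.
- move=> A g [c Lc]; rewrite /= /orbit_boundary_fun /= => clc.
  have [R0|/set0P Rn0] := eqVneq R set0.
    have : closure (orbit_of [set (h * g)%g | h in A]) `<=` set0.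
      have -> : orbit_of [set (h * g)%g | h in A] = set0.
        by rewrite -subset0 => x [h _ [y]]; rewrite R0.
      by rewrite closure0.
    by move/(_ _ clc).
  (* Writing [A] as [A * 1] lets the previous lemma compare the sets [h g R] with [h R]: the compact
     set is [g R] and the translation is [1]. *)
  have <- : [set (h * 1)%g | h in A] = A.
    apply/seteqP; split=> [_ [h Ah <-]|h Ah]; rewrite ?mulg1//.
    by exists h; rewrite ?mulg1.
  apply: (@orbit_boundary_shadow (w g @` R)) => //.
  + by apply/finite_compact/finite_image; exact: subset1_finite.
  + apply/outside_L => _ [y Ry <-].
    apply: act_outside; exact: (outside_L R).1 RL _ Ry.
  + exact: set_mem.
  apply: closureS clc => _ [_ [h Ah <-] [y Ry <-]]; exists h => //.
  by exists (w g y); [exists y | rewrite (hactionM (hactionP w))].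
move=> c c' cc'; have ne : val c <> val c' by move/val_inj.
have [E [F [cE cF EF nF nE]]] := (hausdorff_closed_coverP X).1 hX _ _ ne.
(* [R] has at most one point, so a translate of [R] not inside [E] lies in [F]. *)
exists [set h | w h @` R `<=` E]; split.
  move=> clc; apply: nE; apply: (closure_subset_closed cE) clc.
  by move=> x [h hE hx]; exact: hE.
move=> clc; apply: nF; apply: (closure_subset_closed cF) clc.
move=> _ [h nhE [r Rr <-]]; have [Er|//] : (E `|` F) (w h r) by rewrite EF.
by case: nhE => _ [r' Rr' <-]; rewrite (R1 Rr' Rr).
Qed.

Lemma orbit_boundary_equivariant (e : haction H L) :
  (forall h c, val (e h c) = w h (val c)) ->
  forall h (A : set H) c, orbit_boundary A c ->
    orbit_boundary [set (h * x)%g | x in A] (e h c).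
Proof.
move=> eE h A c clc; rewrite /= /orbit_boundary_fun /= eE.
have := continuous_closure_image (@haction_continuous _ _ _ (hactionP w) h) clc.
apply: closureS => _ [_ [g Ag [r Rr <-]] <-]; exists (h * g)%g; first by exists g.
by exists r => //; rewrite (hactionM (hactionP w)).
Qed.

End OrbitBoundary.

(** * Blowups *)

Section PuncturedSpace.
Variables (Z : topologicalType) (cZ : compact [set: Z]) (hZ : hausdorff_space Z).
Variable q : Z.

Lemma open_punctured : open [set~ q].
Proof. by apply: closed_openC; apply: finite_closed => //; exact: finite_set1. Qed.

Lemma punctured_hausdorff : hausdorff_space [set~ q].
Proof. exact: hausdorff_injective (@val_continuous _ _) val_inj hZ. Qed.

Lemma punctured_locally_compact (v : [set~ q]) : exists2 N, compact N & nbhs v N.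
Proof.
have vq : nbhs (val v) [set~ q].
  by apply: open_nbhs_nbhs; split; [exact: open_punctured | exact: set_valP v].
have [N [cN vN Nq]] := closed_nbhs_shrink cZ hZ vq.
exists (val @^-1` N); last exact: (@val_continuous _ _ v).
by apply: compact_set_type => //; exact: closed_subset_compact.
Qed.

End PuncturedSpace.

Section BoundedParabolicOrbit.
Variables (G : groupType) (Z : topologicalType) (phi : haction G Z).

Definition punctured_translate (x y : Z) g (gx : phi g x = y) (z : [set~ x]) : [set~ y] :=
  exist _ (phi g (val z)) (mem_set (punctured_move gx (z := z))).

Lemma punctured_translate_continuous x y g (gx : phi g x = y) :
  continuous (punctured_translate gx).
Proof.
apply: continuous_set_type => z; apply: continuous_comp.
  exact: val_continuous.
exact: (haction_continuous (hactionP phi)).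
Qed.

(** Translation by [g] conjugates the two punctured actions. A frame names only representatives,
    while every point of their orbits contributes a factor to the blowup. *)
Lemma bounded_parabolic_act g x y : phi g x = y ->
  bounded_parabolic phi x -> bounded_parabolic phi y.
Proof.
move=> gx [pd [K cK Kcov]]; have gy : phi g^-1%g y = x by rewrite -gx hactK.
have conjE (h : Stab phi y) (z : [set~ y]) :
    punctured_act phi x (stab_conj gx h) (punctured_translate gy z) =
    punctured_translate gy (punctured_act phi y h z).
  by apply: val_inj; rewrite /= !(hactionM (hactionP phi)) hactVK.
split.
  move=> L cL; have cL' := compact_image (@punctured_translate_continuous _ _ _ gy) cL.
  have inj : injective (stab_conj gx).
    by move=> h h' /(congr1 val) /= /mulIg/mulgI/val_inj.
  apply: sub_finite_set (finite_preimage (in2W inj) (pd _ cL')) => h.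
  move=> [_ [[k Lk <-] Lhk]]; exists (punctured_translate gy (punctured_act phi y h k)).
  split; last by exists (punctured_act phi y h k).
  by rewrite -conjE; exists (punctured_translate gy k) => //; exists k.
exists (punctured_translate gx @` K).
  exact: compact_image (@punctured_translate_continuous _ _ _ gx) cK.
move=> v; have [h [k Kk hk]] := Kcov (punctured_translate gy v).
exists (stab_conj gy h), (punctured_translate gx k); first by exists k.
apply: val_inj; rewrite /= !(hactionM (hactionP phi)) hactK invgK.
have /= -> := congr1 val hk.
by rewrite hactVK.
Qed.

End BoundedParabolicOrbit.

Section BlowupFactor.
Variables (G : groupType) (Z : topologicalType) (phi : haction G Z).
Hypotheses (cZ : compact [set: Z]) (hZ : hausdorff_space Z).
Variables (F : blowup_frame phi).
Variable D : forall p : reps F, pers_group (Stab phi (val p)).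
Variables (p : reps F) (q : orbit phi (val p)).

Lemma bd_at_perspective : perspective_boundary (bd_at D q).
Proof.
have e : phi (transl F (val p) (val q))^-1%g (val q) = val p.
  by rewrite -[X in phi _ X](transl_eq q) hactK.
apply: (@perspective_boundary_transport _ _ _ _ _ (stab_conj e)).
- by move=> x; apply: val_inj; rewrite /= invgK !mulgA mulgV mul1g mulgK.
- by move=> x; apply: val_inj; rewrite /= invgK !mulgA mulVg mul1g mulgVK.
- by move=> x y; apply: val_inj; rewrite /= !mulgA mulgK.
exact: EPers_perspective_boundary (pg_EPers (D p)).
Qed.

Let Pq : bounded_parabolic phi (val q).
Proof.
have [g gq] := set_valP q.
exact: bounded_parabolic_act gq (repsP (set_valP p)).
Qed.

Lemma blowup_at_hausdorff : hausdorff_space (blowup_at D q).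
Proof.
apply: (@perspective_glue_hausdorff _ _ _ _ (punctured_act phi (val q))
  (core F (val q)) _ bd_at_perspective) => //.
- exact: punctured_hausdorff.
- exact: punctured_locally_compact.
- by case: Pq.
- exact: core_compact.
- exact: core_cover.
Qed.

Lemma blowup_at_null L : compact L ->
  null_family (fun h => (inl : _ -> blowup_at D q) @` (punctured_act phi (val q) h @` L)).
Proof.
apply: (@perspective_glue_null _ _ _ _ (punctured_act phi (val q))
  (core F (val q)) _ bd_at_perspective) => //.
- by case: Pq.
- exact: core_compact.
- exact: core_cover.
Qed.

End BlowupFactor.

Section BlowupSpace.
Variables (G : groupType) (Z : topologicalType) (phi : haction G Z).
Hypotheses (cZ : compact [set: Z]) (hZ : hausdorff_space Z).
Variables (F : blowup_frame phi).
Variable D : forall p : reps F, pers_group (Stab phi (val p)).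

(** Orbits of distinct representatives are disjoint, so a point determines its representative. *)
Lemma blowup_index_inj (j j' : blowup_index F) :
  val (projT2 j) = val (projT2 j') -> j = j'.
Proof.
case: j j' => [p q] [p' q'] qq'.
have pp' : p = p'.
  apply/val_inj/(reps_unique (set_valP p) (set_valP p')).
  have [[g gq] [g' gq']] := (set_valP q, set_valP q').
  exists (g'^-1 * g)%g; rewrite (hactionM (hactionP phi)) gq
    (qq' : val q = val q') -gq' hactK; reflexivity.
by subst p'; congr existT; exact: val_inj.
Qed.

Definition blowup_coord (j : blowup_index F) (w : blowup D) : blowup_factor D j :=
  (val w).2 j.

Lemma blowup_proj_continuous : continuous (@blowup_proj _ _ _ _ D).
Proof.
move=> w; apply: continuous_comp; first exact: val_continuous.
exact: cvg_fst.
Qed.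

Lemma blowup_coord_continuous j : continuous (blowup_coord j).
Proof.
move=> w; apply: (@continuous_comp _ _ _ (fun w : blowup D => (val w).2)
  (fun g => g j)); last exact: prod_topology_proj_continuous.
by apply: continuous_comp; [exact: val_continuous | exact: cvg_snd].
Qed.

Lemma blowup_coord_proj j w : blowup_at_proj (blowup_coord j w) = blowup_proj w.
Proof. exact: set_valP w j. Qed.

Lemma blowup_ext (w w' : blowup D) : blowup_proj w = blowup_proj w' ->
  (forall j, blowup_coord j w = blowup_coord j w') -> w = w'.
Proof.
case: w w' => [[z x] zx] [[z' x'] zx'] /= e ex.
apply: val_inj => /=; rewrite [z]e; congr pair; exact: functional_extensionality_dep.
Qed.

Lemma blowup_hausdorff : hausdorff_space (blowup D).
Proof.
apply: hausdorff_separating => w w' ww'.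
have [e|ne] := pselect (blowup_proj w = blowup_proj w'); last first.
  by exists Z, (@blowup_proj _ _ _ _ D); split=> //; exact: blowup_proj_continuous.
have [j nj] : exists j, blowup_coord j w <> blowup_coord j w'.
  apply: contrapT => all_eq; apply/ww'/blowup_ext => // j.
  by apply: contrapT => nj; apply: all_eq; exists j.
exists (blowup_factor D j), (blowup_coord j); split=> //.
  exact: blowup_at_hausdorff.
exact: blowup_coord_continuous.
Qed.

End BlowupSpace.

Definition point_of (T : Type) (A : set T) x (Ax : A x) : A :=
  exist _ x (mem_set Ax).

Arguments point_of {T} A {x} Ax.

(** * The two implications *)

Lemma exists_subset1 (X : choiceType) (A : set X) :
  {R : set X | [/\ is_subset1 R, R `<=` A & R = set0 -> A = set0]}.
Proof.
have [->|/set0P/cid[x Ax]] := eqVneq A set0; first by exists set0; split.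
exists [set x]; split=> [y z -> ->|y ->|x0] //.
by have : [set x] x by []; rewrite x0.
Qed.

Section Fibers.
Variables (G : groupType) (X Z : topologicalType).
Hypotheses (cX : compact [set: X]) (hX : hausdorff_space X).
Hypotheses (cZ : compact [set: Z]) (hZ : hausdorff_space Z).
Variables (psi : haction G X) (phi : haction G Z) (pi : X -> Z).
Hypothesis pi_continuous : continuous pi.
Hypothesis pi_equivariant : forall g x, pi (psi g x) = phi g (pi x).

Definition fiber (p : Z) : set X := pi @^-1` [set p].

Lemma fiber_closed p : closed (fiber p).
Proof.
have /continuous_closedP := pi_continuous; apply.
by apply: finite_closed => //; exact: finite_set1.
Qed.

Lemma fiber_compact p : compact [set: fiber p].
Proof.
have -> : [set: fiber p] = val @^-1` fiber p.
  by apply/seteqP; split=> // x _; exact: set_valP.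
apply: compact_set_type => //; apply: closed_subset_compact => //.
exact: fiber_closed.
Qed.

Lemma stab_is_haction p : is_haction (fun h : Stab phi p => psi (val h)).
Proof.
split=> [x|g h x|g]; first exact: (haction1 (hactionP psi)).
  exact: (hactionM (hactionP psi)).
exact: (haction_continuous (hactionP psi)).
Qed.

Definition stab_act p : haction (Stab phi p) X := HAction (stab_is_haction p).

Lemma fiber_stab p (h : Stab phi p) x : fiber p x -> fiber p (psi (val h) x).
Proof. by rewrite /fiber /= pi_equivariant => ->; rewrite stabP. Qed.

Definition fiber_act p : haction (Stab phi p) (fiber p) := restr_act (@fiber_stab p).

Lemma compact_punctured_image p K : compact K -> K `&` fiber p = set0 ->
  compact (val @^-1` (pi @` K) : set [set~ p]).
Proof.
move=> cK Kp; apply: compact_set_type; first exact: compact_image.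
move=> _ [x Kx <-] /= xp; have : (K `&` fiber p) x by [].
by rewrite Kp.
Qed.

Lemma stab_act_pd p K : bounded_parabolic phi p ->
  compact K -> K `&` fiber p = set0 ->
  finite_set [set h | (stab_act p h @` K) `&` K !=set0].
Proof.
move=> [pd _] cK Kp.
apply: sub_finite_set (pd _ (compact_punctured_image cK Kp)).
move=> h [_ [[x Kx <-] Khx]].
have nx y : K y -> [set~ p] (pi y).
  by move=> Ky yp; have : (K `&` fiber p) y by []; rewrite Kp.
exists (exist _ (pi (psi (val h) x)) (mem_set (nx _ Khx))).
split; last by exists (psi (val h) x).
exists (exist _ (pi x) (mem_set (nx _ Kx))); first by exists x.
by apply: val_inj; rewrite /= pi_equivariant.
Qed.

Lemma EPers_stab_act_null p :
  EPers (fiber_compl_act pi_equivariant p) (fun w : fiber_compl pi p => val w)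
    (fun h : Stab phi p => psi (val h)) ->
  forall K, compact K -> K `&` fiber p = set0 ->
    null_family (fun h => stab_act p h @` K).
Proof.
move=> E K cK Kp; apply/(null_familyP cX hX) => u eu.
have KW : K `<=` fiber_compl pi p.
  by move=> x Kx xp; have : (K `&` fiber p) x by []; rewrite Kp.
have := EPers_perspective E eu (compact_set_type cK KW).
apply: sub_finite_set => h nsm sm; apply: nsm => -[x y].
move=> /= [[a Ka <-] [b Kb <-]]; apply: sm; split=> /=; [exists a|exists b] => //.
  by exists (exist _ a (mem_set (KW a Ka))).
by exists (exist _ b (mem_set (KW b Kb))).
Qed.

(** * From perspectivity to a blowup *)

Section PerspectiveToBlowup.
Hypothesis pi_surjective : forall z, exists x, pi x = z.
Hypothesis pi_fibers : forall z, ~ bounded_parabolic phi z ->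
  exists x, pi @^-1` [set z] = [set x].
Hypothesis nondegenerate :
  infinite_set [set: G] -> forall p : Z, exists z : Z, z <> p.
Hypothesis X_EPers : forall p, bounded_parabolic phi p ->
  EPers (fiber_compl_act pi_equivariant p) (fun w : fiber_compl pi p => val w)
    (fun h : Stab phi p => psi (val h)).
Variable F : blowup_frame phi.

Definition base (p : Z) : set X := sval (exists_subset1 (fiber_compl pi p)).

Lemma baseP p : [/\ is_subset1 (base p), base p `<=` fiber_compl pi p &
  base p = set0 -> fiber_compl pi p = set0].
Proof. exact: svalP (exists_subset1 (fiber_compl pi p)). Qed.

Lemma base_outside p : base p `&` fiber p = set0.
Proof. by have [_ sub _] := baseP p; rewrite -subset0 => x [/sub]. Qed.

(** If [base p] is empty, the fiber over [p] is all of [X], so [Z] is the point [p] by surjectivity,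
    and [nondegenerate] makes [G] finite. *)
Lemma base_empty_finite p : base p = set0 -> finite_set [set: Stab phi p].
Proof.
have [_ _ W0] := baseP p => /W0 {}W0.
have fG : finite_set [set: G].
  apply: contrapT => /nondegenerate/(_ p)[z zp].
  have [x xz] := pi_surjective z; have : fiber_compl pi p x by rewrite -xz in zp.
  by rewrite W0.
have := finite_preimage (f := val : Stab phi p -> G) (in2W val_inj) fG.
by rewrite preimage_setT.
Qed.

Definition fiber_boundary (p : Z) :
    gluing_map (discrete_topology (Stab phi p)) (fiber p) :=
  orbit_boundary (stab_act p) (fiber p) (base p).

Lemma fiber_EPers p : bounded_parabolic phi p ->
  EPers (lmul (Stab phi p)) (glue_inl (fiber_boundary p))
    (sum_act (lmul (Stab phi p)) (fiber_act p)).
Proof.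
move=> Pp; have [R1 _ _] := baseP p; apply: perspective_boundary_EPers.
- apply: orbit_boundary_perspective => //.
  + exact: fiber_stab.
  + exact: EPers_stab_act_null (X_EPers Pp).
  + by move=> K; exact: stab_act_pd.
  + exact: base_outside.
  + exact: base_empty_finite.
- exact: fiber_compact.
- exact: orbit_boundary_equivariant.
Qed.

Definition fiber_group (p : reps F) : pers_group (Stab phi (val p)) :=
  PersGroup (fiber_EPers (repsP (set_valP p))).

Lemma fiber_pull (p : reps F) (q : orbit phi (val p)) x : pi x = val q ->
  fiber (val p) (psi (transl F (val p) (val q))^-1%g x).
Proof.
by rewrite /fiber /= pi_equivariant => ->; rewrite -[X in phi _ X](transl_eq q) hactK.
Qed.

(** The remainder of the factor at [q] is the fiber over the representative [p], so the fiber over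
    [q] is carried there by the inverse of [transl]. *)
Definition factor_map (p : reps F) (q : orbit phi (val p)) (x : X) :
    blowup_at fiber_group q :=
  match pselect (pi x = val q) with
  | left xq => inr (point_of _ (fiber_pull xq))
  | right xq => inl (point_of [set~ val q] xq)
  end.

Lemma factor_map_proj (p : reps F) (q : orbit phi (val p)) x :
  blowup_at_proj (factor_map q x) = pi x.
Proof. by rewrite /factor_map; case: pselect. Qed.

Lemma factor_map_continuous (p : reps F) (q : orbit phi (val p)) :
  continuous (@factor_map p q).
Proof.
apply/continuous_closedP => B /glue_closedP[].
set S := glue_inl _ @^-1` B; set E := glue_inr _ @^-1` B => cS cE SE x clx.
have Pq : bounded_parabolic phi (val q).
  have [g gq] := set_valP q.
  exact: bounded_parabolic_act gq (repsP (set_valP p)).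
(* Off the fiber over [q], the map is [pi] followed by the inclusion of the punctured space, which
   is open in [Z]. *)
rewrite /= /factor_map; case: pselect => xq; last first.
  have [z zx] : exists z : [set~ val q], val z = pi x.
    by exists (point_of [set~ val q] xq).
  suff : S (point_of [set~ val q] xq) by [].
  apply: contrapT => nS; have oS : open (~` S) by exact: closed_openC.
  have [O oO OS] := oS.
  have nx : nbhs x (pi @^-1` (O `&` [set~ val q])).
    apply: pi_continuous; apply: open_nbhs_nbhs; split.
      by apply: openI => //; exact: open_punctured.
    split=> //; have : (~` S) (point_of [set~ val q] xq) by [].
    by rewrite -OS.
  have [y [By [Oy yq]]] := clx _ nx.
  move: By; rewrite /preimage /= /factor_map; case: pselect => [//|yq'] By.
  have : (~` S) (point_of [set~ val q] yq') by rewrite -OS.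
  by apply.
suff : E (point_of _ (fiber_pull xq)) by [].
pose t := transl F (val p) (val q).
(* The preimage of [B] consists of the translate by [t] of the compact set [E] and of the part lying
   over [S]; the limits of the latter are the real issue. *)
have [cl|cl] : closure (psi t @` (val @` E)) x \/ closure (pi @^-1` (val @` S)) x.
  suff : closure (psi t @` (val @` E) `|` pi @^-1` (val @` S)) x by rewrite closureU.
  apply: closureS clx => y.
  rewrite /preimage /= /factor_map; case: pselect => yq By; [left|right].
    exists (psi t^-1%g y); last by rewrite hactVK.
    by exists (point_of _ (fiber_pull yq)).
  by exists (point_of [set~ val q] yq).
  have clE : closed (psi t @` (val @` E)).
    apply: compact_closed => //; apply: compact_image.
      exact: (haction_continuous (hactionP psi)).
    apply: compact_image; first exact: val_continuous.
    by apply: closed_subset_compact => //; exact: fiber_compact.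
  have [_ [e Ee <-] te] := (closure_subset_closed clE (@subset_refl _ _)) _ cl.
  have <- : e = point_of _ (fiber_pull xq); last by [].
  by apply: val_inj; rewrite /= -te hactK.
(* [B] is closed, so [E] contains the boundary of [S]. It remains to see [t^-1 x] as a limit of the
   orbit of the base point under the conjugates of the elements of [A]. *)
apply: SE.
pose A := hitting (punctured_act phi (val q)) (core F (val q)) S.
change (closure (orbit_of (stab_act (val p)) (base (val p))
  (stab_conj (transl_eq q) @` A)) (psi t^-1%g x)).
have tK y : psi t (psi t^-1%g y) = y by exact: hactVK.
have [R1 RW R0] := baseP (val p).
have [/R0 W0|/set0P Rn0] := eqVneq (base (val p)) set0.
  have [y [[v Sv vy] _]] := cl _ filterT.
  have : fiber_compl pi (val p) (psi t^-1%g y); last by rewrite W0.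
  move=> /= yp; apply: (set_valP v); rewrite vy -[y]tK pi_equivariant yp.
  exact: transl_eq.
have RL : (psi t @` base (val p)) `&` fiber (val q) = set0.
  rewrite -subset0 => _ [[r Rr <-] rq]; apply: (RW r Rr).
  by have := fiber_pull rq; rewrite -/t hactK.
have cK : compact (pi @^-1` (val @` core F (val q))).
  apply: closed_subset_compact => //; have /continuous_closedP := pi_continuous; apply.
  apply: compact_closed => //; apply: compact_image; first exact: val_continuous.
  exact: core_compact.
have KL : pi @^-1` (val @` core F (val q)) `&` fiber (val q) = set0.
  rewrite -subset0 => y [[v _ vy] yq]; apply: (set_valP v).
  by rewrite vy.
have tR1 : is_subset1 (psi t @` base (val p)).
  by move=> _ _ [r Rr <-] [r' Rr' <-]; rewrite (R1 r r').
have tRn0 : psi t @` base (val p) !=set0 by case: Rn0 => r Rr; exists (psi t r), r.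
(* Every point over [S] lies in [k K] for some [k] in [A], where [K] is the preimage of the core. So
   [x] is a limit of the sets [k K], hence of the points [k t r] with [r] the base point. *)
have sh : closure (orbit_of (stab_act (val q)) (psi t @` base (val p))
    [set (h * 1)%g | h in A]) x.
  have sh := orbit_boundary_shadow cX hX (w := stab_act (val q)) (@fiber_stab (val q))
    (EPers_stab_act_null (X_EPers Pq)) tR1 RL (A := A) 1%g tRn0 cK KL xq.
  apply: sh.
  apply: closureS cl => y [v Sv vy]; have [k [c Kc kc]] := core_cover F Pq v.
  exists k; first by exists v; split=> //; exists c.
  exists (psi (val k)^-1%g y); last exact: hactVK.
  by exists c; rewrite // pi_equivariant -vy -kc /= hactK.
(* Applying [t^-1] turns [k t r] into [t^-1 k t r], the translate of [r] by the conjugate of [k]. *)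
have := continuous_closure_image
  (@haction_continuous _ _ _ (hactionP psi) t^-1%g) sh.
apply: closureS => _ [_ [_ [k Ak <-] [_ [r Rr <-] <-]] <-].
exists (stab_conj (transl_eq q) k); first by exists k.
by exists r => //; rewrite /= mulg1 !(hactionM (hactionP psi)).
Qed.

Lemma to_blowup_subproof x : blowup_set
  ((pi x, fun j => factor_map (projT2 j) x) :
     Z * prod_topology (blowup_factor fiber_group)).
Proof. by move=> j; exact: factor_map_proj. Qed.

Definition to_blowup (x : X) : blowup fiber_group :=
  point_of _ (to_blowup_subproof x).

Lemma to_blowup_continuous : continuous to_blowup.
Proof.
have cj : continuous ((fun x j => factor_map (projT2 j) x) :
      X -> prod_topology (blowup_factor fiber_group)).
  by apply: continuous_prod_topology => j; exact: factor_map_continuous.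
apply: continuous_set_type => x; exact: cvg_pair (@pi_continuous x) (cj x).
Qed.

Lemma factor_map_over (p : reps F) (q : orbit phi (val p)) x (xq : pi x = val q) :
  factor_map q x = inr (point_of _ (fiber_pull xq)).
Proof.
by rewrite /factor_map; case: pselect => // xq'; rewrite (Prop_irrelevance xq' xq).
Qed.

Lemma factor_map_away (p : reps F) (q : orbit phi (val p)) x (xq : pi x <> val q) :
  factor_map q x = inl (point_of [set~ val q] xq).
Proof.
by rewrite /factor_map; case: pselect => // xq'; rewrite (Prop_irrelevance xq' xq).
Qed.

Lemma bounded_parabolic_index z : bounded_parabolic phi z ->
  exists j : blowup_index F, val (projT2 j) = z.
Proof.
move=> /(reps_exists F)[p pF pz].
by exists (existT _ (point_of _ pF) (point_of (orbit phi p) pz)).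
Qed.

Lemma to_blowup_injective : injective to_blowup.
Proof.
move=> x y xy; have pxy := congr1 (@blowup_proj _ _ _ F fiber_group) xy.
have [Pz|/pi_fibers[u fu]] := pselect (bounded_parabolic phi (pi x)); last first.
  have : [set u] x by rewrite -fu.
  have : [set u] y by rewrite -fu.
  by move=> -> ->.
have [j jx] := bounded_parabolic_index Pz.
have := congr1 (blowup_coord j) xy; rewrite /blowup_coord /=.
have jy : pi y = val (projT2 j) by rewrite jx.
rewrite (factor_map_over (esym jx)) (factor_map_over jy).
by move=> [] /(can_inj (hactK psi _)).
Qed.

(** The projection forces every coordinate at an index not over [z]. If [z] is bounded parabolic,
    the coordinate at [z] lies in the remainder, hence is a point of the fiber over the
    representative, and [transl] carries it to the preimage. *)
Lemma to_blowup_surjective w : exists x, to_blowup x = w.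
Proof.
pose z := blowup_proj w; have wz j : blowup_at_proj (blowup_coord j w) = z.
  exact: blowup_coord_proj.
have away x (j : blowup_index F) : pi x = z -> val (projT2 j) <> z ->
    factor_map (projT2 j) x = blowup_coord j w.
  move=> xz jz; have xj : pi x <> val (projT2 j) by rewrite xz => /esym.
  rewrite (factor_map_away xj); move: (wz j); case: (blowup_coord j w) => [v|c] //=.
  by move=> vz; congr inl; apply: val_inj; rewrite /= xz.
have [Pz|nPz] := pselect (bounded_parabolic phi z); last first.
  have [x xz] := pi_surjective z; exists x; apply: blowup_ext => // j.
  apply: away => // jz; apply: nPz; rewrite -jz.
  have [g gq] := set_valP (projT2 j).
  exact: bounded_parabolic_act gq (repsP (set_valP (projT1 j))).
have [j jz] := bounded_parabolic_index Pz.
have [c wc] : exists c, blowup_coord j w = inr c.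
  move: (wz j); case: (blowup_coord j w) => [v|c] /= vz; last by exists c.
  by case: (set_valP v); rewrite /= vz jz.
pose x := psi (transl F (val (projT1 j)) (val (projT2 j)))
  (val (c : fiber (val (projT1 j)))).
have xj : pi x = val (projT2 j).
  rewrite pi_equivariant -[RHS](transl_eq (projT2 j)); congr (phi _ _).
  exact: (set_valP (c : fiber (val (projT1 j)))).
exists x; apply: blowup_ext; first by rewrite /blowup_proj /= xj.
move=> j'; have [e|ne] := pselect (val (projT2 j') = z); last first.
  by apply: away => //; rewrite xj.
have -> : j' = j by apply: blowup_index_inj; rewrite e jz.
rewrite wc /blowup_coord /= (factor_map_over xj); congr inr.
by apply: val_inj; rewrite /= hactK.
Qed.

Lemma to_blowup_equivariant g x : to_blowup (psi g x) = blowup_act g (to_blowup x).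
Proof.
apply: blowup_ext; first exact: pi_equivariant.
move=> [p q]; rewrite /blowup_coord /=.
set q' := move_pt g^-1%g q.
have gE : phi g (val q') = val q by exact: hactVK.
have [xq|xq] := pselect (pi x = val q').
  have xq' : pi (psi g x) = val q by rewrite pi_equivariant xq.
  rewrite (factor_map_over xq) (factor_map_over xq') /=; congr inr.
  by apply: val_inj; rewrite /= !(hactionM (hactionP psi)) hactVK.
have xq' : pi (psi g x) <> val q.
  by rewrite pi_equivariant -gE => /(can_inj (hactK phi g)).
rewrite (factor_map_away xq) (factor_map_away xq') /=; congr inl.
by apply: val_inj; rewrite /= pi_equivariant.
Qed.

Lemma to_blowup_homeomorphism : homeomorphism to_blowup.
Proof.
apply: compact_hausdorff_homeomorphism => //.
- exact: blowup_hausdorff.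
- exact: to_blowup_continuous.
- exact: to_blowup_injective.
- exact: to_blowup_surjective.
Qed.

End PerspectiveToBlowup.

(** * From a blowup to quasiconvexity and perspectivity *)

Section BlowupToPerspective.
Variable F : blowup_frame phi.
Variable D : forall p : reps F, pers_group (Stab phi (val p)).
Variable T : X -> blowup D.
Hypotheses (T_continuous : continuous T) (T_injective : injective T).
Hypothesis T_proj : forall x, blowup_proj (T x) = pi x.

Definition coord (j : blowup_index F) (x : X) : blowup_factor D j :=
  blowup_coord j (T x).

Lemma coord_continuous j : continuous (coord j).
Proof.
move=> x; apply: continuous_comp; first exact: T_continuous.
exact: blowup_coord_continuous.
Qed.

Lemma coord_proj j x : blowup_at_proj (coord j x) = pi x.
Proof. by rewrite -T_proj; exact: blowup_coord_proj. Qed.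

Lemma coord_away (j : blowup_index F) x (xj : [set~ val (projT2 j)] (pi x)) :
  coord j x = inl (point_of _ xj).
Proof.
have := coord_proj j x; case: (coord j x) => [v|c] /= e; last by case: xj.
by congr inl; apply: val_inj.
Qed.

Lemma coord_eq_away (j : blowup_index F) x y :
  pi x <> val (projT2 j) -> pi x = pi y -> coord j x = coord j y.
Proof.
move=> xj xy; have yj : pi y <> val (projT2 j) by rewrite -xy.
by rewrite (coord_away (j := j) xj) (coord_away (j := j) yj); congr inl; apply: val_inj.
Qed.

(** Coordinates at points other than [pi x] are determined by [pi x], so injectivity of [T] concerns
    only the coordinate over that point. *)
Lemma coord_injective x y :
  pi x = pi y ->
  (forall j : blowup_index F, val (projT2 j) = pi x -> coord j x = coord j y) ->
  x = y.
Proof.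
move=> xy eq_over; apply/T_injective/blowup_ext; first by rewrite !T_proj.
move=> j; have [/eq_over//|ne] := pselect (val (projT2 j) = pi x).
by apply: coord_eq_away => // /esym.
Qed.

Lemma blowup_quasiconvex : quasiconvex pi.
Proof.
suff nul : null_family (fun z => pi @^-1` [set z]).
  by move=> u; exact: ((null_familyP cX hX _).1 nul u).
move=> A B cA cB AB.
(* [Q M] provides finitely many coordinates that together separate the pairs in [M] with equal image
   in [Z]. *)
pose Q (M : set (X * X)) := exists2 J : set (blowup_index F), finite_set J &
  forall x y, M (x, y) -> pi x = pi y -> ~ (forall j, J j -> coord j x = coord j y).
have sep (Y : topologicalType) (g : X -> Y) x y : hausdorff_space Y -> continuous g ->
    g x <> g y -> nbhs (x, y) [set ab | g ab.1 <> g ab.2].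
  move=> hY cg gxy.
  have [U [V [cU cV UV nV nU]]] := (hausdorff_closed_coverP Y).1 hY _ _ gxy.
  exists (g @^-1` (~` V), g @^-1` (~` U)).
    split; apply: cg; apply: open_nbhs_nbhs; split=> //; exact: closed_openC.
  move=> [a b] [/= Va Ub] ab; have [//|] : (U `|` V) (g b) by rewrite UV.
  by rewrite -ab.
have [J fJ JP] : Q (A `*` B).
  apply: compact_ind.
  - by apply: compact_setX; exact: closed_subset_compact.
  - by exists set0; [exact: finite_set0 | ].
  - by move=> M N MN [J fJ JP]; exists J => // x y /MN; exact: JP.
  - move=> M N [J fJ JP] [J' fJ' JP']; exists (J `|` J'); first by rewrite finite_setU.
    move=> x y [Mxy|Nxy] xy JJ'.
      by apply: (JP _ _ Mxy xy) => j Jj; apply: JJ'; left.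
    by apply: (JP' _ _ Nxy xy) => j Jj; apply: JJ'; right.
  move=> [x y] [/= Ax By]; have nxy : x <> y.
    by move=> xy; have : (A `&` B) x; [split=> //; rewrite xy | rewrite AB].
  have [xy|xy] := pselect (pi x = pi y); last first.
    exists [set ab | pi ab.1 <> pi ab.2]; first exact: sep.
    by exists set0; [exact: finite_set0 | move=> a b /=].
  have [j jxy] : exists j, coord j x <> coord j y.
    apply: contrapT => all_eq; apply: nxy; apply: coord_injective => // j _.
    by apply: contrapT => jxy; apply: all_eq; exists j.
  exists [set ab | coord j ab.1 <> coord j ab.2].
    by apply: sep => //; [exact: blowup_at_hausdorff | exact: coord_continuous].
  exists [set j]; first exact: finite_set1.
  by move=> a b /= nab _ /(_ j erefl).
(* A coordinate at an index not over [z] is constant on the fiber over [z], so a fiber meeting both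
   [A] and [B] lies over a point coming from [J]. *)
apply: sub_finite_set (finite_image (fun j : blowup_index F => val (projT2 j)) fJ).
move=> z [[x [xz Ax]] [y [yz By]]]; apply: contrapT => nz.
have xy : pi x = pi y by rewrite xz yz.
apply: (JP x y) => // j Jj; apply: coord_eq_away => // xj.
by apply: nz; exists j => //; rewrite -xj.
Qed.

Lemma blowup_stab_act_null (j : blowup_index F) (K : set X) :
  compact K -> K `&` fiber (val (projT2 j)) = set0 ->
  null_family (fun h => stab_act (val (projT2 j)) h @` K).
Proof.
move=> cK Kp A B cA cB AB; set q := val (projT2 j) in Kp *.
have Pq : bounded_parabolic phi q.
  have [g gq] := set_valP (projT2 j).
  exact: bounded_parabolic_act gq (repsP (set_valP (projT1 j))).
have hY : hausdorff_space (blowup_factor D j) by exact: blowup_at_hausdorff.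
have cl_image S : closed S -> closed (coord j @` S).
  move=> cS; apply: compact_closed => //; apply: compact_image.
    exact: coord_continuous.
  exact: closed_subset_compact.
(* The images of [A] and [B] in the factor at [q] meet only over [M], which
   avoids [q] because coordinates are injective on the fiber of [q]. *)
pose M := pi @` (A `&` coord j @^-1` (coord j @` B)).
have cM : closed M.
  apply: compact_closed => //; apply: compact_image => //.
  apply: closed_subset_compact => //; apply: closedI => //.
  by have /continuous_closedP := @coord_continuous j; apply; exact: cl_image.
have nMq : ~ M q.
  move=> [x [Ax [y By yx]] xq]; have pxy : pi x = pi y by rewrite -!(coord_proj j) yx.
  suff xy : x = y by have : (A `&` B) x; [split=> //; rewrite xy | rewrite AB].
  by apply: coord_injective => // j'; rewrite xq => /blowup_index_inj ->.
have [N [cN Nq NM]] := closed_nbhs_avoiding cZ hZ cM nMq.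
have cpN (S : set X) : closed S -> closed (S `&` pi @^-1` N).
  by move=> cS; apply: closedI => //; have /continuous_closedP := pi_continuous; apply.
have AB1 : coord j @` (A `&` pi @^-1` N) `&` coord j @` (B `&` pi @^-1` N) = set0.
  rewrite -subset0 => _ [[x [Ax Nx] <-] [y [By Ny] yx]].
  have : (N `&` M) (pi x); last by rewrite NM.
  by split=> //; exists x => //; split=> //; exists y.
pose L : set [set~ q] := val @^-1` (pi @` K).
have cL : compact L by exact: compact_punctured_image.
(* [L'] collects the points far from [q]. If the point of [h K] in [A] or in [B] lies outside [N],
   then [h] moves a point of [L] into [L'], which happens for finitely many [h] by proper
   discontinuity ([fin2]). Otherwise both points lie over [N], and nullity in the factor applies
   ([fin1]). *)
pose L' : set [set~ q] := val @^-1` (~` N°).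
have cL' : compact L'.
  apply: compact_set_type.
    by apply: closed_subset_compact => //; apply: open_closedC; exact: open_interior.
  by move=> z nz zq; apply: nz; rewrite zq.
have fin1 := blowup_at_null (q := projT2 j) cL
  (cl_image _ (cpN _ cA)) (cl_image _ (cpN _ cB)) AB1.
have fin2 := Pq.1 _ (compactU cL cL').
have nK x : K x -> [set~ q] (pi x).
  by move=> Kx xq; have : (K `&` fiber q) x by []; rewrite Kp.
have in_L x (Kx : K x) : L (point_of _ (nK _ Kx)) by exists x.
apply: (@sub_finite_set _ _ (_ `|` _)); last first.
  by rewrite finite_setU; split; [exact: fin1 | exact: fin2].
move=> h [[_ [[x Kx <-] Ax]] [_ [[y Ky <-] By]]].
have translate z (Kz : K z) : [set~ q] (pi (psi (val h) z)).
  by rewrite pi_equivariant => /= e; apply: (nK _ Kz);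
    apply: (can_inj (hactK phi (val h))); rewrite e stabP.
have actE z (Kz : K z) : point_of _ (translate z Kz) =
    punctured_act phi q h (point_of _ (nK _ Kz)).
  by apply: val_inj; rewrite /= pi_equivariant.
have far z (Kz : K z) : ~ N (pi (psi (val h) z)) ->
    (punctured_act phi q h @` (L `|` L')) `&` (L `|` L') !=set0.
  move=> nN; exists (point_of _ (translate z Kz)); split.
    by rewrite actE; exists (point_of _ (nK _ Kz)) => //; left; exact: in_L.
  by right=> /interior_subset.
have [Nx|nNx] := pselect (N (pi (psi (val h) x))); last by right; exact: far nNx.
have [Ny|nNy] := pselect (N (pi (psi (val h) y))); last by right; exact: far nNy.
left; have near_q z (Kz : K z) (S : set X) : S (psi (val h) z) ->
    N (pi (psi (val h) z)) -> ((inl : _ -> blowup_at D (projT2 j)) @`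
      (punctured_act phi q h @` L)) `&` coord j @` (S `&` pi @^-1` N) !=set0.
  move=> Sz Nz; exists (coord j (psi (val h) z)); split; last by exists (psi (val h) z).
  rewrite (coord_away (j := j) (translate z Kz)) actE.
  exists (punctured_act phi q h (point_of _ (nK _ Kz))) => //.
  by exists (point_of _ (nK _ Kz)).
split; [exact: (near_q x Kx A Ax Nx) | exact: (near_q y Ky B By Ny)].
Qed.

Lemma fiber_compl_open_embedding p :
  open_embedding (fun w : fiber_compl pi p => val w).
Proof.
split; [exact: val_inj | exact: val_continuous |].
move=> _ [O oO <-].
have -> : (fun w : fiber_compl pi p => val w) @` (set_val @^-1` O) =
    O `&` fiber_compl pi p.
  apply/seteqP; split=> [_ [w Ow <-]|x [Ox xp]]; first by split=> //; exact: set_valP.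
  by exists (point_of (fiber_compl pi p) xp).
by apply: openI => //; apply: closed_openC; exact: fiber_closed.
Qed.

Lemma setC_range_fiber_compl p :
  ~` range (fun w : fiber_compl pi p => val w) = fiber p.
Proof.
apply/seteqP; split=> [x nx|x xp [w _ wx]].
  by apply: contrapT => xp; apply: nx; exists (point_of (fiber_compl pi p) xp).
by apply: (set_valP w); rewrite wx.
Qed.

Lemma blowup_EPers p : bounded_parabolic phi p ->
  EPers (fiber_compl_act pi_equivariant p) (fun w : fiber_compl pi p => val w)
    (fun h : Stab phi p => psi (val h)).
Proof.
move=> Pp; split=> //.
- exact: fiber_compl_open_embedding.
- rewrite setC_range_fiber_compl; apply: closed_subset_compact => //.
  exact: fiber_closed.
- exact: stab_is_haction.
- by move=> h x; rewrite setC_range_fiber_compl; exact: fiber_stab.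
move=> u K eu cK.
have cK' : compact (val @` K) by apply: compact_image => //; exact: val_continuous.
have Kp : (val @` K) `&` fiber p = set0.
  by rewrite -subset0 => _ [[w _ <-]]; exact: (set_valP w).
apply: ((null_familyP cX hX _).1 _ u eu).
have [p0 p0F p0p] := reps_exists F Pp.
exact: (@blowup_stab_act_null
  (existT _ (point_of _ p0F) (point_of (orbit phi p0) p0p))).
Qed.

End BlowupToPerspective.

End Fibers.

Theorem theorem2p25 (G : groupType) (X Z : topologicalType)
  (X_compact : compact [set: X]) (X_hausdorff : hausdorff_space X)
  (Z_compact : compact [set: Z]) (Z_hausdorff : hausdorff_space Z)
  (psi : haction G X) (phi : haction G Z)
  (pi : X -> Z) (pi_continuous : continuous pi)
  (pi_surjective : forall z, exists x, pi x = z)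
  (pi_equivariant : forall g x, pi (psi g x) = phi g (pi x))
  (pi_fibers : forall z, ~ bounded_parabolic phi z ->
    exists x, pi @^-1` [set z] = [set x])
  (* If Z = {p} and G is infinite, p is vacuously bounded parabolic and (1) does
     not imply (2), e.g. for an irrational rotation of the circle X by G = Z. *)
  (nondegenerate : infinite_set [set: G] -> forall p : Z, exists z : Z, z <> p)
  (F : blowup_frame phi) :
  (quasiconvex pi /\
   forall p, bounded_parabolic phi p ->
     EPers (fiber_compl_act pi_equivariant p)
       (fun w : fiber_compl pi p => val w)
       (fun h : Stab phi p => psi (val h)))
  <->
  (exists (D : forall p : reps F, pers_group (Stab phi (val p)))
          (T : X -> blowup D),
     [/\ homeomorphism T,
         forall g x, T (psi g x) = blowup_act g (T x)
       & forall x, blowup_proj (T x) = pi x]).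
Proof.
split=> [[_ X_EPers]|[D [T [[cT [T' [_ TK _]]] _ T_proj]]]].
  exists (fiber_group X_compact X_hausdorff Z_hausdorff pi_continuous
    pi_surjective nondegenerate X_EPers (F := F)).
  exists (to_blowup X_compact X_hausdorff Z_hausdorff pi_continuous
    pi_surjective nondegenerate X_EPers F).
  split=> //.
  - exact: to_blowup_homeomorphism.
  - exact: to_blowup_equivariant.
have T_inj := can_inj TK.
split=> [u|p Pp].
  exact: (blowup_quasiconvex X_compact X_hausdorff Z_compact Z_hausdorff
    pi_continuous cT T_inj T_proj).
exact: (blowup_EPers X_compact X_hausdorff Z_compact Z_hausdorff
  pi_continuous pi_equivariant cT T_inj T_proj Pp).
Qed.
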